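(* Let $\mathcal{H}$ be generated by a polynomial decay kernel of order $m$, i.e. $\mu_i\asymp i^{-2m}$. Suppose that Assumption A2 holds for $\lambda\asymp\lambda^\dagger:=n^{-\frac{2m}{2m+1}}$ and $m>3/2$. Then $$\|\widehat f_R-f_0\|_n^2=\mathcal{O}_P\big(n^{-\frac{2m}{2m+1}}\big).$$
   Context: Model: $y_i=f_0(x_i)+\epsilon_i$, $i=1,\dots,n$, where $x_1,\dots,x_n$ are i.i.d. from a distribution $P_X$ on $\mathcal{X}\subseteq\mathbb{R}^d$ ($d\ge1$ fixed), $\epsilon_i$ are i.i.d. $N(0,1)$ and independent of $(x_1,\dots,x_n)$ and $S$, and $f_0\in\mathcal{H}$ is the true (fixed) regression function. Kernel: $\mathcal{H}\subset L^2(P_X)$ is an RKHS with inner product $\langle\cdot,\cdot\rangle_{\mathcal{H}}$ and reproducing kernel $K(x,x')=\sum_{i=1}^\infty\mu_i\phi_i(x)\phi_i(x')$, with ordered eigenvalues $\mu_1\ge\mu_2\ge\cdots\ge0$, where $\{\phi_i\}$ is a basis of $L^2(P_X)$ with $\langle\phi_i,\phi_j\rangle_{L^2(P_X)}=\delta_{ij}$ and $\langle\phi_i,\phi_j\rangle_{\mathcal{H}}=\delta_{ij}/\mu_i$. Assumption A1 (standing): $\sup_{i\ge1}\|\phi_i\|_{\sup}<\infty$ and $\sup_{k\ge1}\frac{\sum_{i=k+1}^\infty\mu_i}{k\mu_k}<\infty$. Estimator: $\boldsymbol{K}=[n^{-1}K(x_i,x_j)]_{1\le i,j\le n}$, $\boldsymbol{y}=(y_1,\dots,y_n)^\top$;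 for an $s\times n$ real random matrix $S$, $\widehat\beta=\frac1n(S\boldsymbol{K}^2S^\top+\lambda S\boldsymbol{K}S^\top)^{-1}S\boldsymbol{K}\boldsymbol{y}$, $\widehat f_R(\cdot)=\sum_{i=1}^n(S^\top\widehat\beta)_iK(\cdot,x_i)$. $\|g\|_n^2=\frac1n\sum_{i=1}^ng(x_i)^2$. Let $\boldsymbol{K}=UDU^\top$, $UU^\top=I_n$, $D=\mathrm{diag}(\widehat\mu_1,\dots,\widehat\mu_n)$, $\widehat\mu_1\ge\cdots\ge\widehat\mu_n\ge0$. Let $\widehat s_\lambda=\min\{i:\widehat\mu_i\le\lambda\}-1$ and $s_\lambda=\min\{i:\mu_i\le\lambda\}-1$. Write $U=(U_1,U_2)$ with $U_1$ the first $\widehat s_\lambda$ columns, and $D_2=\mathrm{diag}(\widehat\mu_{\widehat s_\lambda+1},\dots,\widehat\mu_n)$. $S$ is $\boldsymbol{K}$-satisfiable if there is a constant $c>0$ with $\|(SU_1)^\top SU_1-I_{\widehat s_\lambda}\|_{\mathrm{op}}\le1/2$ and $\|SU_2D_2^{1/2}\|_{\mathrm{op}}\le c\lambda^{1/2}$. An event $\mathcal{E}$ is of $(a,b)$-type, $a,b\in(0,\infty]$, if $P(P(\mathcal{E}\mid x_1,\dots,x_n)\ge1-e^{-a})\ge1-e^{-b}$. Assumption A2: (a) $s\ge ds_\lambda$ for a sufficiently large constant $d>0$; (b) there exist $c_1,c_2\in(0,\infty]$ such that the event ''$S$ is $\boldsymbol{K}$-satisfiable'' is of $(c_1s,c_2s_\lambda)$-type.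 *)

(* Defs.v *)
From HB Require Import structures.
From mathcomp Require Import all_boot all_order all_algebra.
From mathcomp Require Import all_classical all_reals all_analysis.
Import Order.TTheory GRing.Theory Num.Theory.
Import numFieldNormedType.Exports.

Set Implicit Arguments.
Unset Strict Implicit.
Unset Printing Implicit Defensive.

Local Open Scope classical_set_scope.
Local Open Scope ring_scope.

Section kernel.
Context {R : realType} {dT : measure_display} {T : measurableType dT}.
Implicit Types (X : set T) (PX : probability T R) (K : T -> T -> R).
Implicit Types (H : set (T -> R)) (ip : (T -> R) -> (T -> R) -> R).

(* Functions on X are represented by functions on the ambient space T; two
   elements of H that agree on X are the same vector, hence rkhs_ip_def. *)
Record rkhs X K H ip : Prop := {
  rkhs_0 : H 0;
  rkhs_lin : forall a f g, H f -> H g -> H (a *: f + g);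
  rkhs_ip_sym : forall f g, H f -> H g -> ip f g = ip g f;
  rkhs_ip_lin : forall a f g h, H f -> H g -> H h ->
    ip (a *: f + g) h = a * ip f h + ip g h;
  rkhs_ip_ge0 : forall f, H f -> 0 <= ip f f;
  rkhs_ip_def : forall f, H f ->
    (ip f f = 0 <-> forall z, X z -> f z = 0);
  rkhs_complete : forall u : nat -> T -> R, (forall k, H (u k)) ->
    (forall e, 0 < e -> \forall k \near \oo, forall l, (k <= l)%N ->
       ip (u l - u k) (u l - u k) < e) ->
    exists2 f, H f & (fun k => ip (u k - f) (u k - f)) @ \oo --> (0 : R);
  rkhs_kernel : forall z, X z -> H (K z);
  rkhs_reproducing : forall f z, H f -> X z -> ip f (K z) = f z }.

(* The eigenvalues and eigenfunctions are numbered from 0: mu i and phi i are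
   the (i+1)-st ones. *)
Record eigen_system X PX K H ip (mu : nat -> R) (phi : nat -> T -> R) : Prop :=
{ eigen_ge0 : forall i, 0 <= mu i;
  eigen_ordered : nonincreasing_seq mu;
  eigen_L2 : forall i, phi i \in Lfun PX 2%:E;
  eigen_orthonormal : forall i j,
    \int[PX]_z (phi i z * phi j z) = (i == j)%:R :> R;
  eigen_basis : forall f, f \in Lfun PX 2%:E -> exists a : nat -> R,
    (fun k => Lnorm PX 2%:E (fun z => (f z - \sum_(i < k) a i * phi i z)%:E))
      @ \oo --> 0%E;
  eigen_H : forall i, 0 < mu i -> H (phi i);
  eigen_orthogonal : forall i j, 0 < mu i -> 0 < mu j ->
    ip (phi i) (phi j) = (i == j)%:R / mu i;
  eigen_kernel : forall z z', X z -> X z' ->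
    series (fun i => mu i * phi i z * phi i z') @ \oo --> K z z' }.

Definition phi_bounded X (phi : nat -> T -> R) : Prop :=
  exists M : R, forall i z, X z -> `|phi i z| <= M.

(* sup_(k >= 1) (sum_(i > k) mu_i) / (k mu_k) < oo in 1-based numbering, with
   k.+1 for k; the quotient is cleared, mu k being nonzero in all cases where
   it makes sense. *)
Definition tail_bounded (mu : nat -> R) : Prop :=
  exists C : R, forall k,
    (\sum_(k.+1 <= i <oo) (mu i)%:E <= (C * (k.+1%:R * mu k))%:E)%E.

End kernel.

Section probability_notions.
Context {R : realType} {dW : measure_display} {W : measurableType dW}.
Variable P : probability W R.

(* Independent with common law Q, for random variables x i (measurability is
   carried by their type at the point of use).
   The product rule over the whole finite family covers its subfamilies: take
   A i = setT for the other indices. *)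
Definition iid_from (dT : measure_display) (T : measurableType dT) (n : nat)
    (x : 'I_n -> W -> T) (Q : set T -> \bar R) : Prop :=
  (forall i A, measurable A -> P (x i @^-1` A) = Q A) /\
  (forall A : 'I_n -> set T, (forall i, measurable (A i)) ->
     P (\bigcap_i (x i @^-1` A i)) = \prod_(i < n) P (x i @^-1` A i))%E.

Definition indep_systems (F G : set (set W)) : Prop :=
  forall A B, F A -> G B -> P (A `&` B) = (P A * P B)%E.

Definition sigma_mx (p q : nat) (S : W -> 'M[R]_(p, q)) : set (set W) :=
  <<s \bigcup_i \bigcup_j
        preimage_set_system setT (fun w => S w i j) measurable >>.

(* g is a version of the conditional probability of E given G. *)
Definition cond_prob (G : set (set W)) (E : set W) (g : W -> R) : Prop :=
  [/\ forall B : set R, measurable B -> G (g @^-1` B),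
      P.-integrable setT (EFin \o g) &
      forall A, G A -> (\int[P]_(w in A) (g w)%:E = P (E `&` A))%E].

(* P(P(E | G) >= 1 - e^-a) >= 1 - e^-b; two versions of P(E | G) agree almost
   surely, so the choice of version is immaterial. *)
Definition ab_type (G : set (set W)) (E : set W) (a b : \bar R) : Prop :=
  [/\ (0 < a)%E, (0 < b)%E, measurable E &
      exists2 g, cond_prob G E g &
        (1 - expeR (- b) <= P [set w | 1 - expeR (- a) <= (g w)%:E])%E].

End probability_notions.

Definition bigO_in_probability {R : realType} (dW : nat -> measure_display)
    (W : forall n, measurableType (dW n)) (P : forall n, probability (W n) R)
    (Z : forall n, W n -> R) (r : nat -> R) : Prop :=
  forall e : R, 0 < e -> exists M : R, \forall n \near \oo,
    (P n [set w | (M * r n < `|Z n w|)%R] <= e%:E)%E.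

Section matrices.
Context {R : realType}.

Definition l2norm n (v : 'cV[R]_n) : R := Num.sqrt (\sum_i v i 0 ^+ 2).

Definition opnorm p q (A : 'M[R]_(p, q)) : R :=
  sup [set l2norm (A *m v) | v in [set v : 'cV[R]_q | l2norm v <= 1]].

Definition spectral n (K U : 'M[R]_n) (D : 'rV[R]_n) : Prop :=
  [/\ K = U *m diag_mx D *m U^T, U *m U^T = 1%:M,
      forall i j : 'I_n, (i <= j)%N -> D 0 j <= D 0 i &
      forall i, 0 <= D 0 i].

(* Both dimensions below are min {i : i-th eigenvalue <= lam} - 1 for
   eigenvalues numbered from 1, that is, the least index numbered from 0.  If
   every empirical eigenvalue exceeds lam, then s_hat is n. *)
Definition s_hat n (lam : R) (D : 'rV[R]_n) : nat :=
  find (fun i => D 0 i <= lam) (enum 'I_n).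

Lemma s_hat_le n lam (D : 'rV[R]_n) : (s_hat lam D <= n)%N.
Proof. by rewrite -[leqRHS]size_enum_ord find_size. Qed.

(* The value 0 is a default for the case of an empty minimum, which does not
   occur when lam > 0 and mu tends to 0. *)
Definition s_lam (mu : nat -> R) (lam : R) : nat :=
  if pselect (exists i, mu i <= lam) is left h then ex_minn h else 0.

Definition head_ord k n (h : (k <= n)%N) : 'I_k -> 'I_n := widen_ord h.

Definition tail_ord k n (h : (k <= n)%N) (j : 'I_(n - k)) : 'I_n :=
  cast_ord (subnKC h) (rshift k j).

Definition satisfiable (c lam : R) n (K : 'M[R]_n) p (S : 'M[R]_(p, n)) : Prop :=
  exists U D, spectral K U D /\
    let h := s_hat_le lam D in
    let U1 := colsub (head_ord h) U in
    let U2 := colsub (tail_ord h) U in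
    let D2 := colsub (tail_ord h) D in
    opnorm ((S *m U1)^T *m (S *m U1) - 1%:M) <= 2^-1 /\
    opnorm (S *m U2 *m diag_mx (map_mx Num.sqrt D2)) <= c * Num.sqrt lam.

End matrices.

Section estimator.
Context {R : realType} {T : Type}.
Variables (K : T -> T -> R) (n : nat).

Definition kernel_mx (x : 'I_n -> T) : 'M[R]_n :=
  \matrix_(i, j) (n%:R^-1 * K (x i) (x j)).

(* pinvmx M is the inverse of M whenever M is invertible (pinvmxE).  Otherwise
   it is a generalized inverse, so that beta_hat still solves the normal
   equations (S K^2 S^T + lam S K S^T) beta = n^-1 S K y. *)
Definition beta_hat p (lam : R) (S : 'M[R]_(p, n)) (x : 'I_n -> T)
    (y : 'cV[R]_n) : 'cV[R]_p :=
  let Kx := kernel_mx x in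
  n%:R^-1 *: (pinvmx (S *m (Kx *m Kx) *m S^T + lam *: (S *m Kx *m S^T))
              *m (S *m Kx *m y)).

Definition f_hat p (lam : R) (S : 'M[R]_(p, n)) (x : 'I_n -> T)
    (y : 'cV[R]_n) (z : T) : R :=
  \sum_i (S^T *m beta_hat lam S x y) i 0 * K z (x i).

Definition emp_norm2 (x : 'I_n -> T) (g : T -> R) : R :=
  n%:R^-1 * \sum_i g (x i) ^+ 2.

End estimator.

(* Main.v *)
Require Import Defs.
From HB Require Import structures.
From mathcomp Require Import all_boot all_order all_algebra.
From mathcomp Require Import all_classical all_reals all_analysis.
From mathcomp Require Import measurable_realfun ring lra.
Import Order.TTheory GRing.Theory Num.Theory.
Import numFieldNormedType.Exports.

(** The fitted values at the sample points form the vector A y, where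
    A = K S^T M^+ S K and M = S (K^2 + lam K) S^T (here K is the kernel matrix
    and M^+ a generalized inverse).  With f the vector of values of f0 and e the
    noise, the error vector is (A f - f) + A e, and the two parts are bounded
    separately.

    Bias.  A f minimizes the penalized least squares criterion
    |K S^T b - f|^2 + lam (S^T b)^T K (S^T b) over b ([smoother_bias]), so it is
    enough to exhibit one good b.  On the event that S is K-satisfiable,
    S U_1 is nearly an isometry, so b can be chosen in its range so that K S^T b
    reproduces f exactly along the leading eigenvectors; what is left is
    supported on the trailing ones, where eigenvalues are at most lam and where
    S is controlled by the second half of satisfiability.  This costs a constant
    times n lam |f0|_H^2 ([satisfiable_approx]).

    Variance.  The normal equations give |A v|^2 <= v^T A v <= |v|^2 and
    lam v^T A v <= v^T K v for every v, hence |A e|^2 <= e^T A e, whose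
    expectation is proportional to the expectation of the trace of A by
    independence of the noise from (x, S).  The trace is bounded for every sample
    and every sketch: project onto the span of the first N eigenfunctions
    evaluated at the sample, use A <= 1 there and A <= K / lam on the orthogonal
    complement, where only the tail of the kernel expansion survives.  As the
    eigenfunctions are uniformly bounded, this gives
    tr A <= N + (const / lam) sum_(k >= N) mu_k ([mxtrace_smoother_le]), without
    comparing empirical with population eigenvalues.

    With N of order n^(1/(2m+1)), polynomial decay makes the trace of order N,
    and N / n is the announced rate; so is lam.  Markov's inequality and the fact
    that the satisfiability event has probability tending to 1, because both s
    and s_lam tend to infinity, conclude ([emp_error_tail]).

    Probabilities of non-measurable sets carry no information, so the error must
    also be shown to be a measurable function, although the generalized inverse
    is not a continuous function of the matrix.  It is enough that A is the
    limit of K S^T (M + d)^-1 S K as d tends to 0 ([cvg_ridged_smoother]). *)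

Set Implicit Arguments.
Unset Strict Implicit.
Unset Printing Implicit Defensive.

Local Open Scope classical_set_scope.
Local Open Scope ring_scope.

(** * Quadratic forms and the sketched smoother *)

Section quadratic_forms.
Context {R : realType}.

(** Discriminant of a nonnegative quadratic polynomial, in the form that yields
    every Cauchy-Schwarz inequality below. *)
Lemma quad_discr (a b c : R) :
  (forall t, 0 <= a + (b * t) *+ 2 + c * t ^+ 2) -> b ^+ 2 <= a * c.
Proof.
move=> h; have c0 : 0 <= c.
  rewrite leNgt; apply/negP => c0.
  have a0 : 0 <= a by have := h 0; rewrite mulr0 mul0rn addr0 expr0n mulr0 addr0.
  (* If c < 0, adding the values at t and - t leaves 2 (a + c t^2), which is
     negative at this t. *)
  pose t := 1 - a / c; have ct : c * t = c - a.
    by rewrite mulrBr mulr1 mulrCA divff ?mulr1// lt_eqF.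
  have ac0 : 0 <= - (a / c) by rewrite -mulrN -invrN divr_ge0// oppr_ge0 ltW.
  by have := h t; have := h (- t); rewrite /t in ct *; nra.
have [c00|cn0] := eqVneq c 0.
  rewrite c00 mulr0; suff -> : b = 0 by rewrite expr0n.
  apply/eqP/negP => /negP bn0.
  have := h (- ((a + 1) / (b *+ 2))).
  rewrite c00 mul0r addr0.
  have -> : b * - ((a + 1) / (b *+ 2)) *+ 2 = - (a + 1).
    by field.
  lra.
have := h (- (b / c)).
have -> : a + (b * - (b / c)) *+ 2 + c * (- (b / c)) ^+ 2 = (a * c - b ^+ 2) / c.
  by field.
have {}cn0 : 0 < c by rewrite lt_neqAle eq_sym cn0.
by rewrite pmulr_lge0 ?invr_gt0// subr_ge0.
Qed.

Definition dot n (u v : 'cV[R]_n) : R := (u^T *m v) 0 0.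

Lemma dotE n (u v : 'cV[R]_n) : dot u v = \sum_i u i 0 * v i 0.
Proof. by rewrite /dot mxE; apply: eq_bigr => i _; rewrite mxE. Qed.

Lemma dotC n (u v : 'cV[R]_n) : dot u v = dot v u.
Proof. by rewrite !dotE; under eq_bigr do rewrite mulrC. Qed.

Lemma dotDr n (u v w : 'cV[R]_n) : dot u (v + w) = dot u v + dot u w.
Proof. by rewrite /dot mulmxDr mxE. Qed.

Lemma dotDl n (u v w : 'cV[R]_n) : dot (v + w) u = dot v u + dot w u.
Proof. by rewrite dotC dotDr !(dotC _ u). Qed.

Lemma dotNr n (u v : 'cV[R]_n) : dot u (- v) = - dot u v.
Proof. by rewrite /dot mulmxN mxE. Qed.

Lemma dotNl n (u v : 'cV[R]_n) : dot (- v) u = - dot v u.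
Proof. by rewrite dotC dotNr (dotC _ u). Qed.

Lemma dotZr n (u v : 'cV[R]_n) a : dot u (a *: v) = a * dot u v.
Proof. by rewrite /dot -scalemxAr mxE. Qed.

Lemma dotZl n (u v : 'cV[R]_n) a : dot (a *: v) u = a * dot v u.
Proof. by rewrite dotC dotZr (dotC _ u). Qed.

Lemma dot_mulmxr n p (u : 'cV[R]_n) (A : 'M[R]_(n, p)) v :
  dot u (A *m v) = dot (A^T *m u) v.
Proof. by rewrite /dot trmx_mul trmxK mulmxA. Qed.

Definition dot_lin := (dotDr, dotDl, dotNr, dotNl, dotZr, dotZl).

Lemma dot_delta n (v : 'cV[R]_n) i : dot (delta_mx i 0) v = v i 0.
Proof.
rewrite dotE (bigD1 i)//= big1 => [|k /negbTE ki].
  by rewrite mxE !eqxx mul1r addr0.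
by rewrite mxE ki mul0r.
Qed.

Lemma entry_dot n p (A : 'M[R]_(n, p)) i j :
  A i j = dot (delta_mx i 0) (A *m delta_mx j 0).
Proof. by rewrite dot_delta -colE mxE. Qed.

Lemma dotvv_ge0 n (u : 'cV[R]_n) : 0 <= dot u u.
Proof. by rewrite dotE sumr_ge0// => i _; rewrite -expr2 sqr_ge0. Qed.

Lemma dotvv_eq0 n (u : 'cV[R]_n) : dot u u = 0 -> u = 0.
Proof.
rewrite dotE => /psumr_eq0P u0; apply/matrixP => i j; rewrite ord1 mxE.
have /eqP : u i 0 * u i 0 = 0.
  by apply: u0 => // k _; rewrite -expr2 sqr_ge0.
by rewrite mulf_eq0 orbb => /eqP.
Qed.

Record psd n (K : 'M[R]_n) : Prop := {
  psd_sym : K^T = K ;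
  psd_ge0 : forall v, 0 <= dot v (K *m v) }.

Lemma psd_dotC n (K : 'M[R]_n) u v : K^T = K -> dot u (K *m v) = dot v (K *m u).
Proof. by move=> sK; rewrite dot_mulmxr sK dotC. Qed.

Lemma psd_cauchy n (K : 'M[R]_n) u v : psd K ->
  dot u (K *m v) ^+ 2 <= dot u (K *m u) * dot v (K *m v).
Proof.
move=> pK; apply: quad_discr => t.
have := psd_ge0 pK (u + t *: v).
rewrite mulmxDr -scalemxAr !dot_lin (psd_dotC v u) ?(psd_sym pK)//.
by congr (0 <= _); ring.
Qed.

Lemma psd1 n : psd (1%:M : 'M[R]_n).
Proof. by split; [rewrite trmx1 | move=> v; rewrite mul1mx dotvv_ge0]. Qed.

Lemma dot_cauchy n (u v : 'cV[R]_n) : dot u v ^+ 2 <= dot u u * dot v v.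
Proof. by have := psd_cauchy u v (psd1 n); rewrite !mul1mx. Qed.

(** For a symmetric matrix the range is the orthogonal complement of the
    kernel, and [pinvmx] solves every consistent system. *)
Lemma sym_solvable n (M : 'M[R]_n) b : M^T = M ->
  (forall u, M *m u = 0 -> dot u b = 0) -> M *m (pinvmx M *m b) = b.
Proof.
move=> sM kb; have : (b^T <= M)%MS.
  rewrite submxE; apply/eqP/matrixP => i j; rewrite ord1 [RHS]mxE.
  have -> : (b^T *m cokermx M) 0 j = dot b (col j (cokermx M)).
    rewrite /dot; have -> : b^T *m col j (cokermx M) = col j (b^T *m cokermx M).
      by rewrite !colE mulmxA.
    by rewrite [RHS]mxE.
  by rewrite dotC kb// colE mulmxA mulmx_coker mul0mx.
case/submxP => Z /(congr1 trmx); rewrite trmxK trmx_mul sM => ->.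
by have := mulmxKpV (submx_refl M); move: (pinvmx M) => N {3}<-; rewrite !mulmxA.
Qed.

End quadratic_forms.

Section smoother.
Context {R : realType}.
Variables (n p : nat) (K : 'M[R]_n) (S : 'M[R]_(p, n)) (lam : R).

(** Coefficient matrix of the normal equations solved by [beta_hat]. *)
Definition sketched_normal_mx : 'M[R]_p :=
  S *m (K *m K) *m S^T + lam *: (S *m K *m S^T).

Definition smoother : 'M[R]_n :=
  K *m S^T *m pinvmx sketched_normal_mx *m S *m K.

Local Notation M := sketched_normal_mx.
Local Notation A := smoother.

Hypotheses (pK : psd K) (lam0 : 0 < lam).

Let sK : K^T = K := psd_sym pK.

Lemma sketched_normal_mxE u v : dot u (M *m v) =
  dot (K *m (S^T *m u)) (K *m (S^T *m v)) +
  lam * dot (S^T *m u) (K *m (S^T *m v)).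
Proof.
rewrite /M mulmxDl dotDr -scalemxAl dotZr -!mulmxA.
by rewrite dot_mulmxr dot_mulmxr sK -(dot_mulmxr u S).
Qed.

Lemma psd_sketched_normal_mx : psd M.
Proof.
split.
  by rewrite /M linearD linearZ /= !trmx_mul trmxK sK -!mulmxA.
move=> v; rewrite sketched_normal_mxE addr_ge0 ?dotvv_ge0//.
by rewrite mulr_ge0 ?(ltW lam0)//; exact: psd_ge0.
Qed.

Definition sketch_coef v : 'cV[R]_p := pinvmx M *m (S *m (K *m v)).

(** The normal equations are consistent: a vector killed by M has zero energy,
    hence is sent to 0 by K S^T. *)
Lemma sketch_coefP v : M *m sketch_coef v = S *m (K *m v).
Proof.
apply: sym_solvable; first exact: psd_sym psd_sketched_normal_mx.
move=> u Mu0; have := sketched_normal_mxE u u.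
rewrite Mu0 [LHS]mxE big1 => [|i _]; last by rewrite [X in _ * X]mxE mulr0.
have := dotvv_ge0 (K *m (S^T *m u)).
have := mulr_ge0 (ltW lam0) (psd_ge0 pK (S^T *m u)).
move=> h1 h2 h3; rewrite dot_mulmxr dot_mulmxr sK.
have /dotvv_eq0 -> : dot (K *m (S^T *m u)) (K *m (S^T *m u)) = 0 by lra.
by rewrite dotE big1// => i _; rewrite mxE mul0r.
Qed.

Lemma smootherE v : A *m v = K *m (S^T *m sketch_coef v).
Proof. by rewrite /A /sketch_coef -!mulmxA. Qed.

Lemma dot_smoother u v : dot u (A *m v) = dot (sketch_coef u) (M *m sketch_coef v).
Proof.
rewrite smootherE dot_mulmxr sK dot_mulmxr trmxK -sketch_coefP.
by rewrite dotC (psd_dotC _ _ (psd_sym psd_sketched_normal_mx)).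
Qed.

Lemma psd_smoother : psd A.
Proof.
split; last by move=> v; rewrite dot_smoother; exact: psd_ge0 psd_sketched_normal_mx _.
have sym u v : dot u (A *m v) = dot v (A *m u).
  by rewrite !dot_smoother (psd_dotC _ _ (psd_sym psd_sketched_normal_mx)).
apply/matrixP => i j; rewrite mxE.
by rewrite !(entry_dot A) sym.
Qed.

(** Both sides are b^T M b, where b solves the normal equations for v.  The
    three inequalities that follow are read off this identity. *)
Lemma smoother_energy v :
  dot v (A *m v) = dot (A *m v) (A *m v) +
    lam * dot (S^T *m sketch_coef v) (K *m (S^T *m sketch_coef v)).
Proof. by rewrite dot_smoother sketched_normal_mxE smootherE. Qed.

Lemma smoother_sq_le v : dot (A *m v) (A *m v) <= dot v (A *m v).
Proof.
rewrite smoother_energy lerDl mulr_ge0 ?(ltW lam0)//; exact: psd_ge0.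
Qed.

Lemma smoother_le1 v : dot v (A *m v) <= dot v v.
Proof.
have := dotvv_ge0 (v - A *m v); rewrite !dot_lin (dotC (A *m v) v).
have := smoother_sq_le v; lra.
Qed.

(** Cauchy-Schwarz for the form K bounds v^T A v by the energies of v and of
    the fit, and [smoother_energy] bounds the latter by v^T A v / lam. *)
Lemma smoother_leK v : lam * dot v (A *m v) <= dot v (K *m v).
Proof.
set w := S^T *m sketch_coef v.
have e := smoother_energy v; have a0 := dotvv_ge0 (A *m v).
have w0 : 0 <= dot w (K *m w) by exact: psd_ge0.
have v0 : 0 <= dot v (K *m v) by exact: psd_ge0.
have := psd_cauchy v w pK; rewrite -{1}smootherE => cs.
have [->|q0] := eqVneq (dot v (A *m v)) 0; first by rewrite mulr0.
have {}q0 : 0 < dot v (A *m v).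
  by rewrite lt_neqAle eq_sym q0 (psd_ge0 psd_smoother).
rewrite -(ler_pM2r q0) -mulrA -expr2.
apply: le_trans (ler_wpM2l (ltW lam0) cs) _.
rewrite mulrCA ler_wpM2l//. by rewrite e lerDr.
Qed.

(** The penalized criterion is a convex quadratic function of b whose critical
    point is given by the normal equations. *)
Lemma smoother_bias f b :
  dot (A *m f - f) (A *m f - f) <=
    dot (K *m (S^T *m b) - f) (K *m (S^T *m b) - f) +
    lam * dot (S^T *m b) (K *m (S^T *m b)).
Proof.
set b0 := sketch_coef f.
have [d ->] : exists d, b = b0 + d by exists (b - b0); rewrite addrC subrK.
have J x : dot (K *m (S^T *m x) - f) (K *m (S^T *m x) - f) +
    lam * dot (S^T *m x) (K *m (S^T *m x)) =
    dot x (M *m x) - dot x (S *m (K *m f)) *+ 2 + dot f f.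
  have -> : dot x (S *m (K *m f)) = dot (K *m (S^T *m x)) f.
    by rewrite !dot_mulmxr sK.
  by rewrite sketched_normal_mxE !dot_lin (dotC f); ring.
have -> : dot (A *m f - f) (A *m f - f) = dot (K *m (S^T *m b0) - f) (K *m (S^T *m b0) - f).
  by rewrite smootherE.
apply: (@le_trans _ _ (dot (K *m (S^T *m b0) - f) (K *m (S^T *m b0) - f) +
    lam * dot (S^T *m b0) (K *m (S^T *m b0)))).
  by rewrite lerDl mulr_ge0 ?(ltW lam0)//; exact: psd_ge0.
rewrite !J -sketch_coefP -/b0 mulmxDr !dot_lin.
rewrite (psd_dotC b0 d) ?(psd_sym psd_sketched_normal_mx)//.
have := psd_ge0 psd_sketched_normal_mx d; lra.
Qed.

End smoother.

(** * Trace of the smoother *)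

Section traces.
Context {R : realType}.

Lemma mulmx_ext n p (A B : 'M[R]_(n, p)) : (forall v : 'cV_p, A *m v = B *m v) -> A = B.
Proof. by move=> AB; apply/matrixP => i j; rewrite !(entry_dot _ i j) AB. Qed.

Lemma sym_dotP n (A : 'M[R]_n) :
  (forall u v, dot u (A *m v) = dot v (A *m u)) -> A^T = A.
Proof. by move=> sA; apply/matrixP => i j; rewrite mxE !entry_dot sA. Qed.

(** The rank factorization E = C R of an idempotent satisfies R C = 1. *)
Lemma mxtrace_idem n (E : 'M[R]_n) : E *m E = E -> \tr E = (\rank E)%:R.
Proof.
have /row_fullP[B] := col_base_full E; have /row_freeP[C] := row_base_free E.
move: (col_base E) (row_base E) (mulmx_base E) B C => c r.
move: (\rank E) c r => k c r <- B C rC Bc EE.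
have rc : r *m c = 1%:M.
  have := congr1 (fun X => B *m X *m C) EE.
  by rewrite /= !mulmxA Bc !mul1mx -!mulmxA rC !mulmx1.
by rewrite mxtrace_mulC rc mxtrace1.
Qed.

Lemma mxtrace_dot n (B : 'M[R]_n) :
  \tr B = \sum_i dot (delta_mx i 0) (B *m delta_mx i 0).
Proof. by apply: eq_bigr => i _; rewrite entry_dot. Qed.

Lemma mxtrace_congr_le n p (B C : 'M[R]_n) (Q : 'M[R]_(n, p)) :
  (forall v, dot v (B *m v) <= dot v (C *m v)) ->
  \tr (Q^T *m B *m Q) <= \tr (Q^T *m C *m Q).
Proof.
move=> BC; rewrite !mxtrace_dot ler_sum// => i _.
by rewrite -!mulmxA !(dot_mulmxr _ Q^T) trmxK.
Qed.

Section projector.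
Variables (n N : nat) (V : 'M[R]_(n, N)).

(** Orthogonal projector onto the column space of V. *)
Definition projector : 'M[R]_n := V *m pinvmx (V^T *m V) *m V^T.

Let gramT : (V^T *m V)^T = V^T *m V.
Proof. by rewrite trmx_mul trmxK. Qed.

Let proj_coef (v : 'cV_n) : V^T *m V *m (pinvmx (V^T *m V) *m (V^T *m v)) = V^T *m v.
Proof.
apply: sym_solvable => // u Gu0.
have /dotvv_eq0 Vu0 : dot (V *m u) (V *m u) = 0.
  by rewrite -[V in X in dot X _]trmxK -dot_mulmxr mulmxA Gu0 /dot mulmx0 mxE.
by rewrite dot_mulmxr trmxK Vu0 /dot trmx0 mul0mx mxE.
Qed.

Lemma projectorE (v : 'cV_n) : projector *m v = V *m (pinvmx (V^T *m V) *m (V^T *m v)).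
Proof. by rewrite /projector -!mulmxA. Qed.

Lemma tr_projector : projector^T = projector.
Proof.
pose c (v : 'cV_n) := pinvmx (V^T *m V) *m (V^T *m v).
have Pc u v : dot u (projector *m v) = dot (c v) (V^T *m V *m c u).
  by rewrite projectorE dot_mulmxr proj_coef dotC.
by apply: sym_dotP => u v; rewrite !Pc (psd_dotC _ _ gramT).
Qed.

Lemma mul_tr_projector : V^T *m projector = V^T.
Proof. by apply: mulmx_ext => v; rewrite -mulmxA projectorE mulmxA proj_coef. Qed.

Lemma projector_mul : projector *m V = V.
Proof.
by apply: trmx_inj; rewrite trmx_mul tr_projector mul_tr_projector.
Qed.

Lemma projector_idem : projector *m projector = projector.
Proof. by rewrite {1}/projector -mulmxA mul_tr_projector. Qed.

Lemma mxtrace_projector : \tr projector <= N%:R.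
Proof.
rewrite mxtrace_idem ?projector_idem// ler_nat /projector -mulmxA.
by apply: leq_trans (mxrankM_maxl _ _) _; exact: rank_leq_col.
Qed.

(** Split the trace along P and 1 - P; use A <= 1 on the first part and
    lam A <= K on the second. *)
Lemma mxtrace_le_projector (A K : 'M[R]_n) (lam : R) : 0 <= lam ->
  (forall v, dot v (A *m v) <= dot v v) ->
  (forall v, lam * dot v (A *m v) <= dot v (K *m v)) ->
  lam * \tr A <= lam * N%:R + \tr (K *m (1%:M - projector)).
Proof.
move=> lam0 A1 AK; set P := projector; set Q := 1%:M - P.
have sP : P^T = P := tr_projector.
have PP : P *m P = P := projector_idem.
have sQ : Q^T = Q by rewrite /Q linearB /= trmx1 sP.
have QQ : Q *m Q = Q.
  by rewrite /Q mulmxBr mulmx1 mulmxBl mul1mx PP subrr subr0.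
have trP B : \tr (P^T *m B *m P) = \tr (B *m P).
  by rewrite -mulmxA mxtrace_mulC -mulmxA sP PP.
have trQ B : \tr (Q^T *m B *m Q) = \tr (B *m Q).
  by rewrite -mulmxA mxtrace_mulC -mulmxA sQ QQ.
have -> : A = A *m P + A *m Q by rewrite -mulmxDr /Q addrC subrK mulmx1.
rewrite mxtraceD mulrDr lerD//.
  rewrite ler_wpM2l// -trP; apply: le_trans mxtrace_projector; rewrite -/P.
  have -> : \tr P = \tr (P^T *m 1%:M *m P) by rewrite trP mul1mx.
  by apply: mxtrace_congr_le => v; rewrite mul1mx.
rewrite -mxtraceZ scalemxAl -[leLHS]trQ -[leRHS]trQ; apply: mxtrace_congr_le => v.
by rewrite -scalemxAl dotZr.
Qed.

End projector.

End traces.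

Section feature_trace.
Context {R : realType}.
Variables (n N : nat) (K : 'M[R]_n) (mu : nat -> R) (phi : nat -> 'cV[R]_n).
Variables (b T : R).
Hypotheses (mu0 : forall k, 0 <= mu k) (b0 : 0 <= b).
Hypothesis Kphi : forall i j,
  series (fun k => mu k * phi k i 0 * phi k j 0) @ \oo --> K i j.
Hypothesis phib : forall k, dot (phi k) (phi k) <= b.
Hypothesis muT : forall L, \sum_(N <= k < L) mu k <= T.

(** If K is the sum of mu_k phi_k phi_k^T, the complement of the first N
    features kills the head of the sum and can only shorten the other phi_k. *)
Lemma mxtrace_feature_tail :
  let V := \matrix_(i < n, k < N) phi k i 0 in
  \tr (K *m (1%:M - projector V)) <= b * T.
Proof.
cbv zeta; set V := \matrix_(_, _) _; set P := projector V; set Q := 1%:M - P.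
have sP : P^T = P := tr_projector V.
have PP : P *m P = P := projector_idem V.
have PV : P *m V = V := projector_mul V.
have Qphi k : (k < N)%N -> Q *m phi k = 0.
  move=> kN; have -> : phi k = col (Ordinal kN) V.
    by apply/matrixP => i j; rewrite ord1 !mxE.
  rewrite colE mulmxA /Q mulmxBl mul1mx.
  by rewrite PV subrr mul0mx.
have Qle k : dot (phi k) (Q *m phi k) <= b.
  apply: le_trans (phib k); rewrite /Q mulmxBl mul1mx !dot_lin gerBl.
  by rewrite -PP -mulmxA dot_mulmxr sP dotvv_ge0.
have trE B : \tr (B *m Q) = \sum_i \sum_j B i j * Q j i.
  by apply: eq_bigr => i _; rewrite mxE.
have cvg : (fun L => \sum_i \sum_j
   (series (fun k => mu k * phi k i 0 * phi k j 0) L * Q j i)) @ \oo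
   --> \tr (K *m Q).
  rewrite trE; apply: cvg_big => [|i _]; first exact: add_continuous.
  apply: cvg_big => [|j _]; first exact: add_continuous.
  by apply: cvgMr_tmp; exact: Kphi.
apply: (cvgr_to_le cvg); near=> L.
have -> : \sum_i \sum_j
   (series (fun k => mu k * phi k i 0 * phi k j 0) L * Q j i) =
   \sum_(0 <= k < L) mu k * dot (phi k) (Q *m phi k).
  rewrite /series/=; under eq_bigr do under eq_bigr do rewrite mulr_suml.
  under eq_bigr do rewrite exchange_big/=.
  rewrite exchange_big/=; apply: eq_bigr => k _.
  have sQ i j : Q j i = Q i j by rewrite -[Q in LHS]trmxK mxE /Q linearB /= trmx1 sP.
  rewrite dotE mulr_sumr; apply: eq_bigr => i _.
  rewrite mxE !mulr_sumr; apply: eq_bigr => j _.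
  by rewrite sQ; ring.
have NL : (N <= L)%N by near: L; exact: nbhs_infty_ge.
rewrite (big_cat_nat _ NL)//= big_nat big1 ?add0r => [|k /andP[_ kN]]; last first.
  by rewrite Qphi// dotE big1 ?mulr0// => i _; rewrite mxE mulr0.
apply: le_trans (ler_wpM2l b0 (muT L)); rewrite mulr_sumr.
by apply: ler_sum => k _; rewrite mulrC ler_wpM2r.
Unshelve. all: by end_near. Qed.

End feature_trace.

(** * Bias on the satisfiability event *)

Section operator_norm.
Context {R : realType}.

Lemma l2norm_dot n (v : 'cV[R]_n) : l2norm v = Num.sqrt (dot v v).
Proof. by rewrite /l2norm dotE; congr Num.sqrt; apply: eq_bigr => i _; rewrite expr2. Qed.

Lemma dot_mulmx_ub p q (A : 'M[R]_(p, q)) v :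
  dot (A *m v) (A *m v) <= (\sum_i dot (row i A)^T (row i A)^T) * dot v v.
Proof.
rewrite [leLHS]dotE mulr_suml; apply: ler_sum => i _; rewrite -expr2.
have -> : (A *m v) i 0 = dot (row i A)^T v.
  by rewrite /dot trmxK -row_mul [RHS]mxE.
exact: dot_cauchy.
Qed.

(** [opnorm] is a supremum, which is informative only because the set is bounded:
    here by the sum of the squared norms of the rows. *)
Lemma opnorm_sq_le p q (A : 'M[R]_(p, q)) b v : opnorm A <= b ->
  dot (A *m v) (A *m v) <= b ^+ 2 * dot v v.
Proof.
move=> Ab; have [v0|v0] := eqVneq (dot v v) 0.
  by rewrite v0 mulr0 (dotvv_eq0 v0) mulmx0 /dot mulmx0 mxE.
have {}v0 : 0 < dot v v by rewrite lt_neqAle eq_sym v0 dotvv_ge0.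
set r := Num.sqrt (dot v v); have r0 : 0 < r by rewrite sqrtr_gt0.
have rE : r ^+ 2 = dot v v by rewrite sqr_sqrtr ?dotvv_ge0.
have : l2norm (A *m (r^-1 *: v)) <= b.
  apply: le_trans Ab; apply: ub_le_sup; last first.
    exists (r^-1 *: v) => //=; rewrite l2norm_dot !dot_lin -rE.
    by rewrite expr2 mulKf ?gt_eqF// mulVf ?gt_eqF// sqrtr1.
  exists (Num.sqrt (\sum_i dot (row i A)^T (row i A)^T)) => _ [u /= u1 <-].
  rewrite l2norm_dot ler_sqrt; last by apply: sumr_ge0 => i _; exact: dotvv_ge0.
  apply: le_trans (dot_mulmx_ub _ _) _; rewrite ler_piMr//.
    by apply: sumr_ge0 => i _; exact: dotvv_ge0.
  by rewrite -sqrtr1 l2norm_dot ler_sqrt in u1.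
rewrite l2norm_dot -scalemxAr !dot_lin => h.
have b0 : 0 <= b by apply: le_trans h; exact: sqrtr_ge0.
have : r^-1 * (r^-1 * dot (A *m v) (A *m v)) <= b ^+ 2.
  rewrite -[leLHS]sqr_sqrtr ?lerXn2r ?nnegrE ?sqrtr_ge0//.
  by rewrite !mulr_ge0 ?dotvv_ge0// invr_ge0 ltW.
by rewrite mulrA -invfM -expr2 rE mulrC ler_pdivrMr.
Qed.

Lemma opnorm_tr_sq_le p q (A : 'M[R]_(p, q)) b v : opnorm A <= b ->
  dot (A^T *m v) (A^T *m v) <= b ^+ 2 * dot v v.
Proof.
move=> Ab; set u := A^T *m v.
have [u0|u0] := eqVneq (dot u u) 0.
  by rewrite u0 mulr_ge0 ?sqr_ge0 ?dotvv_ge0.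
have {}u0 : 0 < dot u u by rewrite lt_neqAle eq_sym u0 dotvv_ge0.
have uu : dot u u = dot v (A *m u) by rewrite dot_mulmxr.
rewrite -(ler_pM2r u0) -expr2 [in leLHS]uu.
apply: le_trans (dot_cauchy _ _) _.
have := ler_wpM2l (dotvv_ge0 v) (opnorm_sq_le u Ab); lra.
Qed.

End operator_norm.

Section head_tail.
Context {R : realType}.

Lemma big_head_tail k n (h : (k <= n)%N) (F : 'I_n -> R) :
  \sum_i F i = \sum_j F (head_ord h j) + \sum_j F (tail_ord h j).
Proof.
rewrite (reindex (cast_ord (subnKC h))); last first.
  by exists (cast_ord (esym (subnKC h))) => i _; rewrite ?cast_ordK ?cast_ordKV.
rewrite big_split_ord; congr (_ + _); apply: eq_bigr => j _; congr F.
exact/val_inj.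
Qed.

Variables (n : nat) (lam : R) (D : 'rV[R]_n).

Let h := s_hat_le lam D.

Lemma s_hat_head j : lam < D 0 (head_ord h j).
Proof.
have := @before_find _ (head_ord h j) (fun i => D 0 i <= lam) (enum 'I_n) j (ltn_ord j).
have -> : nth (head_ord h j) (enum 'I_n) j = head_ord h j.
  by rewrite -[j : nat]/(head_ord h j : nat) nth_ord_enum.
by rewrite leNgt => /negbFE.
Qed.

Lemma s_hat_tail j : (forall i j : 'I_n, (i <= j)%N -> D 0 j <= D 0 i) ->
  D 0 (tail_ord h j) <= lam.
Proof.
move=> mD; have kn : (s_hat lam D < n)%N by rewrite -subn_gt0 (leq_ltn_trans _ (ltn_ord j)).
apply: le_trans (mD (Ordinal kn) _ _) _; first by rewrite /= leq_addr.
have := @nth_find _ (Ordinal kn) (fun i => D 0 i <= lam) (enum 'I_n).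
rewrite has_find size_enum_ord => /(_ kn) /=.
by rewrite -[find _ _]/(Ordinal kn : nat) nth_ord_enum.
Qed.

End head_tail.

Section bias.
Context {R : realType}.
Variables (n p : nat) (K : 'M[R]_n) (S : 'M[R]_(p, n)) (c lam h : R).
Variable f : 'cV[R]_n.
Hypotheses (lam0 : 0 < lam) (h0 : 0 <= h).
Hypothesis hf : forall a, dot a f ^+ 2 <= h * dot a (K *m a).

(** Write z = U^T f.  The hypothesis on f says that f lies in the image under
    K^(1/2) of a ball of squared radius h, so that the sum of z_i^2 / D_i over the
    head and the sum of z_i^2 / lam over the tail are at most h.  The vector b is
    S_1 y, where S_1 = S U_1 and (S_1^T S_1) y = D_1^-1 z_1; then D U^T S^T b agrees
    with z on the head, and the near isometry of S_1 bounds b. *)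
Lemma satisfiable_approx : satisfiable c lam K S ->
  exists b, dot (K *m (S^T *m b) - f) (K *m (S^T *m b) - f) +
    lam * dot (S^T *m b) (K *m (S^T *m b)) <= h * lam * (3 + c ^+ 2 *+ 6).
Proof.
move=> [U [D [[KE UU' mD D0]]]] /=.
set k := s_hat_le lam D.
set S1 := S *m _; set S2 := S *m _; move=> [G1 S2D].
have U'U : U^T *m U = 1%:M by exact: mulmx1C.
have KU u : dot u (K *m u) = \sum_i D 0 i * (U^T *m u) i 0 ^+ 2.
  rewrite KE -!mulmxA dot_mulmxr mul_diag_mx dotE; apply: eq_bigr => i _.
  by rewrite [X in _ * X]mxE; ring.
set z := U^T *m f.
have hz (v : 'cV_n) : (\sum_i v i 0 * z i 0) ^+ 2 <= h * \sum_i D 0 i * v i 0 ^+ 2.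
  have := hf (U *m v); rewrite KU mulmxA U'U mul1mx.
  by rewrite -{1}[U]trmxK -dot_mulmxr dotE.
have fE : f = U *m z by rewrite /z mulmxA UU' mul1mx.
clearbody z.
(* The bounds on q, r and |b|^2 below all arise as r^2 <= s r. *)
have self_le (r s : R) : 0 <= r -> 0 <= s -> r ^+ 2 <= s * r -> r <= s.
  move=> r0 s0; have [->//|rn0] := eqVneq r 0.
  by rewrite expr2 ler_pM2r// lt_neqAle eq_sym rn0.
pose H := head_ord k; pose T := tail_ord k.
have DH j : lam < D 0 (H j) := s_hat_head j.
have DT j : D 0 (T j) <= lam := s_hat_tail j mD.
have DH0 j : 0 < D 0 (H j) := lt_trans lam0 (DH j).
have Hk j : (H j < s_hat lam D)%N by rewrite /= ltn_ord.
have Tk j : (T j < s_hat lam D)%N = false by rewrite /= ltnNge leq_addr.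
pose q := \sum_j z (H j) 0 ^+ 2 / D 0 (H j).
have q0 : 0 <= q by apply: sumr_ge0 => j _; rewrite divr_ge0 ?sqr_ge0.
have qh : q <= h.
  apply: self_le => //.
  (* The test vector is D_1^-1 z_1 on the head. *)
  have := hz (\col_i if (i < s_hat lam D)%N then z i 0 / D 0 i else 0).
  rewrite !(big_head_tail k) -/H -/T.
  rewrite [X in (_ + X) ^+ 2]big1 => [|j _]; last by rewrite mxE Tk mul0r.
  rewrite [X in _ * (_ + X)]big1 => [|j _]; last by rewrite mxE Tk expr0n mulr0.
  rewrite !addr0; congr (_ ^+ 2 <= _ * _).
    by apply: eq_bigr => j _; rewrite mxE Hk mulrAC -expr2.
  apply: eq_bigr => j _; rewrite mxE Hk.
  by field; rewrite gt_eqF.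
pose r := \sum_j z (T j) 0 ^+ 2.
have r0 : 0 <= r by apply: sumr_ge0 => j _; rewrite sqr_ge0.
have rh : r <= h * lam.
  apply: self_le => //; first by rewrite mulr_ge0 ?(ltW lam0).
  (* The test vector is z_2 on the tail. *)
  have := hz (\col_i if (i < s_hat lam D)%N then 0 else z i 0).
  rewrite !(big_head_tail k) -/H -/T.
  rewrite [X in (X + _) ^+ 2]big1 => [|j _]; last by rewrite mxE Hk mul0r.
  rewrite [X in _ * (X + _)]big1 => [|j _]; last by rewrite mxE Hk expr0n mulr0.
  rewrite !add0r => hr.
  have -> : r = \sum_j (\col_i if (i < s_hat lam D)%N then 0 else z i 0) (T j) 0 * z (T j) 0.
    by apply: eq_bigr => j _; rewrite mxE Tk expr2.
  apply: le_trans hr _; rewrite -mulrA ler_wpM2l// mulr_sumr.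
  by apply: ler_sum => j _; rewrite mxE Tk -expr2 ler_wpM2r// sqr_ge0.
set G := S1^T *m S1 in G1.
(* The operator norm bound gives G >= 1/2 as quadratic forms. *)
have Gge v : dot v v <= dot v (G *m v) *+ 2.
  have := dot_cauchy v ((G - 1%:M) *m v).
  have := ler_wpM2l (dotvv_ge0 v) (opnorm_sq_le v G1).
  rewrite mulmxBl mul1mx [dot v (G *m v - v)]dotDr dotNr.
  have := dotvv_ge0 v; move: (dot (_ - _) _) => w; nra.
have sG : G^T = G by rewrite trmx_mul trmxK.
pose a : 'cV_(s_hat lam D) := \col_j (z (H j) 0 / D 0 (H j)).
have [y Gy] : exists y, G *m y = a.
  exists (pinvmx G *m a); apply: sym_solvable => // u Gu0.
  have := Gge u; rewrite Gu0 {2}/dot mulmx0 mxE mul0rn => u0.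
  have /dotvv_eq0 -> : dot u u = 0 by apply/eqP; rewrite eq_le u0 dotvv_ge0.
  by rewrite /dot trmx0 mul0mx mxE.
pose b := S1 *m y; exists b.
have bb : dot b b = dot y a.
  by rewrite -Gy -mulmxA [RHS]dot_mulmxr trmxK.
have aa : dot a a <= q / lam.
  rewrite dotE /q mulr_suml; apply: ler_sum => j _; rewrite !mxE.
  rewrite [leLHS](_ : _ = z (H j) 0 ^+ 2 / D 0 (H j) * (D 0 (H j))^-1); last first.
    by field; rewrite gt_eqF.
  rewrite ler_wpM2l ?lef_pV2 ?posrE ?(ltW (DH j))//.
  by rewrite divr_ge0 ?sqr_ge0// ltW.
have bh : dot b b * lam <= h *+ 2.
  have : dot b b <= dot a a *+ 2.
    apply: self_le; rewrite ?mulrn_wge0 ?dotvv_ge0//.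
    rewrite {1}bb; apply: le_trans (dot_cauchy _ _) _.
    have := ler_wpM2r (dotvv_ge0 a) (Gge y); rewrite Gy bb; lra.
  move: aa; rewrite ler_pdivlMr// => aa.
  move=> /(ler_wpM2r (ltW lam0)); lra.
have colT l (g : 'I_l -> 'I_n) w j :
    ((S *m colsub g U)^T *m w) j 0 = (U^T *m (S^T *m w)) (g j) 0.
  rewrite trmx_mul -mulmxA [LHS]mxE [RHS]mxE; apply: eq_bigr => i _.
  by congr (_ * _); rewrite !mxE.
set t := U^T *m (S^T *m b).
have tH j : t (H j) 0 = z (H j) 0 / D 0 (H j).
  have : (S1^T *m b) j 0 = a j 0 by rewrite /b mulmxA Gy.
  by rewrite [RHS]mxE => <-; rewrite colT.
pose e := \sum_j D 0 (T j) * t (T j) 0 ^+ 2.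
have eh : e <= c ^+ 2 * h *+ 2.
  have := opnorm_tr_sq_le b S2D.
  rewrite exprMn sqr_sqrtr ?(ltW lam0)// => le1.
  apply: (@le_trans _ _ (c ^+ 2 * lam * dot b b)); last first.
    by rewrite -mulrA -mulrnAr ler_wpM2l ?sqr_ge0// mulrC.
  apply: le_trans le1; rewrite dotE le_eqVlt; apply/orP; left; apply/eqP.
  apply: eq_bigr => j _; rewrite trmx_mul tr_diag_mx -mulmxA mul_diag_mx.
  by rewrite [X in _ = X * X]mxE colT !mxE -expr2 exprMn sqr_sqrtr.
have -> : dot (S^T *m b) (K *m (S^T *m b)) = q + e.
  rewrite KU (big_head_tail k) -/H -/T -/t; congr (_ + _).
  by apply: eq_bigr => j _; rewrite tH; field; rewrite gt_eqF.
have -> : dot (K *m (S^T *m b) - f) (K *m (S^T *m b) - f) =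
    \sum_i (D 0 i * t i 0 - z i 0) ^+ 2.
  have -> : K *m (S^T *m b) - f = U *m (diag_mx D *m t - z).
    by rewrite mulmxBr -fE /t !mulmxA -KE.
  rewrite dot_mulmxr mulmxA U'U mul1mx dotE; apply: eq_bigr => i _.
  by rewrite mul_diag_mx !mxE expr2.
rewrite (big_head_tail k) -/H -/T [X in X + _ + _]big1 ?add0r => [|j _]; last first.
  by rewrite tH mulrC divfK ?subrr ?expr0n// gt_eqF.
have : \sum_j (D 0 (T j) * t (T j) 0 - z (T j) 0) ^+ 2 <= lam * e *+ 2 + r *+ 2.
  rewrite /e /r mulr_sumr -!sumrMnl -big_split; apply: ler_sum => j _ /=.
  have d0 := D0 (T j); have dl := DT j.
  have := sqr_ge0 (D 0 (T j) * t (T j) 0 + z (T j) 0).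
  have : 0 <= (lam - D 0 (T j)) * (D 0 (T j) * t (T j) 0 ^+ 2).
    by rewrite mulr_ge0 ?subr_ge0// mulr_ge0 ?sqr_ge0.
  lra.
move: (\sum_j _) => x xle.
have := ler_wpM2l (ltW lam0) eh; have := ler_wpM2l (ltW lam0) qh; lra.
Qed.
End bias.

(** * Measurability of the smoother *)

Section ridge_limit.
Context {R : realType}.
Variables (n p : nat) (K : 'M[R]_n) (S : 'M[R]_(p, n)) (lam : R).
Hypotheses (pK : psd K) (lam0 : 0 < lam).

Local Notation M := (sketched_normal_mx K S lam).

(** The normal equations of [smoother], made invertible by a ridge d. *)
Definition ridged_smoother (d : R) : 'M[R]_n :=
  K *m S^T *m invmx (M + d%:M) *m S *m K.

Lemma unitmx_ridge (d : R) : 0 < d -> M + d%:M \in unitmx.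
Proof.
move=> d0; rewrite -row_free_unit -kermx_eq0; apply/rowV0P => v /sub_kermxP vM.
suff /dotvv_eq0/(congr1 trmx) : dot v^T v^T = 0 by rewrite trmxK trmx0.
have sM := psd_sym (psd_sketched_normal_mx S pK lam0).
have Mv : (M + d%:M) *m v^T = 0.
  by rewrite -[LHS]trmxK trmx_mul trmxK linearD /= tr_scalar_mx sM vM trmx0.
have : dot v^T ((M + d%:M) *m v^T) = 0 by rewrite Mv /dot mulmx0 mxE.
rewrite mulmxDl mul_scalar_mx !dot_lin.
have := psd_ge0 (psd_sketched_normal_mx S pK lam0) v^T.
have := dotvv_ge0 v^T; nra.
Qed.

(** If b solves M b = g and b - e solves the ridged equations for the same g,
    then M e + d e = d b, which forces e to be no longer than b and the two
    smoothers to differ by O(d). *)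
Lemma ridged_smoother_near (d : R) u v : 0 < d ->
  `|dot u (smoother K S lam *m v) - dot u (ridged_smoother d *m v)| <=
  d * (dot (sketch_coef K S lam u) (sketch_coef K S lam u) +
       dot (sketch_coef K S lam v) (sketch_coef K S lam v)).
Proof.
move=> d0; set bu := sketch_coef K S lam u; set bv := sketch_coef K S lam v.
have pM := psd_sketched_normal_mx S pK lam0.
pose bd := invmx (M + d%:M) *m (S *m (K *m v)).
have [e eE] : exists e, bd = bv - e by exists (bv - bd); rewrite opprB addrC subrK.
have Me : M *m e + d *: e = d *: bv.
  have := mulKVmx (unitmx_ridge d0) (S *m (K *m v)); rewrite -/bd eE.
  rewrite -(sketch_coefP S pK lam0 v) -/bv; move: M => N.
  rewrite mulmxBr !mulmxDl !mul_scalar_mx => /(canRL (subrK _)).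
  by move=> /addrI ->.
have uK w : dot u (K *m (S^T *m w)) = dot bu (M *m w).
  rewrite [RHS](psd_dotC _ _ (psd_sym pM)) (sketch_coefP S pK lam0).
  by rewrite [RHS]dot_mulmxr [RHS]dot_mulmxr (psd_sym pK) dotC.
have -> : dot u (smoother K S lam *m v) - dot u (ridged_smoother d *m v) =
    d * (dot bu bv - dot bu e).
  have : dot bu (M *m e) + d * dot bu e = d * dot bu bv by rewrite -!dotZr -dotDr Me.
  rewrite smootherE /ridged_smoother -!mulmxA -/bd -/bv !uK eE mulmxBr.
  by rewrite dotDr dotNr; lra.
have ee : dot e e <= dot bv bv.
  have : d * dot e e <= d * dot e bv.
    rewrite -(dotZr e bv) -Me !dot_lin; have := psd_ge0 pM e; lra.
  rewrite ler_pM2l// => le1; have := dotvv_ge0 (bv - e).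
  rewrite !dot_lin (dotC bv e); have := dotvv_ge0 e; lra.
rewrite normrM gtr0_norm// ler_wpM2l ?(ltW d0)//.
have := dotvv_ge0 (bu - bv); have := dotvv_ge0 (bu + bv).
have := dotvv_ge0 (bu - e); have := dotvv_ge0 (bu + e).
rewrite !dot_lin (dotC bv bu) (dotC e bu) => h1 h2 h3 h4.
by rewrite ler_norml; apply/andP; split; lra.
Qed.

Lemma cvg_ridged_smoother i j :
  (fun k => ridged_smoother k.+1%:R^-1 i j) @ \oo --> smoother K S lam i j.
Proof.
pose C := dot (sketch_coef K S lam (delta_mx i 0)) (sketch_coef K S lam (delta_mx i 0))
  + dot (sketch_coef K S lam (delta_mx j 0)) (sketch_coef K S lam (delta_mx j 0)).
apply/cvgrPdist_le => e e0.
have : (fun k => (@harmonic R k) * C) @ \oo --> 0 * C.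
  by apply: cvgMr_tmp; exact: cvg_harmonic.
rewrite mul0r => /cvgr0_norm_le/(_ _ e0) h; near=> k.
rewrite !entry_dot; apply: le_trans (ridged_smoother_near _ _ _) _ => //.
rewrite -/C; apply: le_trans (ler_norm _) _.
by near: k; exact: h.
Unshelve. all: by end_near. Qed.

End ridge_limit.

Section measurable_matrices.
Context {R : realType} {d : measure_display} {T : measurableType d}.

Definition measurable_mx p q (A : T -> 'M[R]_(p, q)) :=
  forall i j, measurable_fun setT (fun w => A w i j).

Lemma measurable_mx_mul p q r (A : T -> 'M[R]_(p, q)) (B : T -> 'M[R]_(q, r)) :
  measurable_mx A -> measurable_mx B -> measurable_mx (fun w => A w *m B w).
Proof.
move=> mA mB i j; under eq_fun do rewrite mxE.
by apply: measurable_sum => k; apply: measurable_funM; [exact: mA|exact: mB].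
Qed.

Lemma measurable_mx_add p q (A B : T -> 'M[R]_(p, q)) :
  measurable_mx A -> measurable_mx B -> measurable_mx (fun w => A w + B w).
Proof.
move=> mA mB i j; under eq_fun do rewrite mxE.
by apply: measurable_funD; [exact: mA|exact: mB].
Qed.

Lemma measurable_mx_scale p q (f : T -> R) (A : T -> 'M[R]_(p, q)) :
  measurable_fun setT f -> measurable_mx A -> measurable_mx (fun w => f w *: A w).
Proof.
move=> mf mA i j; under eq_fun do rewrite mxE.
by apply: measurable_funM => //; exact: mA.
Qed.

Lemma measurable_mx_cst p q (A : 'M[R]_(p, q)) : measurable_mx (fun _ : T => A).
Proof. by move=> i j; exact: measurable_cst. Qed.

Lemma measurable_mx_tr p q (A : T -> 'M[R]_(p, q)) :
  measurable_mx A -> measurable_mx (fun w => (A w)^T).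
Proof. by move=> mA i j; under eq_fun do rewrite mxE; exact: mA. Qed.

Lemma measurable_det p (A : T -> 'M[R]_p) :
  measurable_mx A -> measurable_fun setT (fun w => \det (A w)).
Proof.
move=> mA; apply: measurable_sum => s; apply: measurable_funM => //.
by apply: measurable_prod => i _; exact: mA.
Qed.

Lemma measurable_mx_adj p (A : T -> 'M[R]_p) :
  measurable_mx A -> measurable_mx (fun w => \adj (A w)).
Proof.
move=> mA i j; under eq_fun do rewrite mxE /cofactor.
apply: measurable_funM => //; apply: measurable_det => k l.
by under eq_fun do rewrite !mxE; exact: mA.
Qed.

(** The inverse is x times exp (- ln x^2), also at 0, where both vanish. *)
Lemma measurable_funV (f : T -> R) : measurable_fun setT f ->
  measurable_fun setT (fun w => (f w)^-1).
Proof.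
move=> mf; have -> : (fun w => (f w)^-1) = (fun w => f w * expR (- ln (f w ^+ 2))).
  apply/funext => w; have [->|x0] := eqVneq (f w) 0; first by rewrite invr0 mul0r.
  by rewrite expRN lnK ?posrE ?exprn_even_gt0// expr2 invfM mulrA divff// mul1r.
apply: measurable_funM => //; apply: measurableT_comp => //.
apply: measurable_funN; apply: measurableT_comp => //; exact: measurable_funX.
Qed.

Lemma measurable_mx_inv p (A : T -> 'M[R]_p) : (forall w, A w \in unitmx) ->
  measurable_mx A -> measurable_mx (fun w => invmx (A w)).
Proof.
move=> uA mA; rewrite (_ : (fun w => _) = fun w => (\det (A w))^-1 *: \adj (A w)).
  apply: measurable_mx_scale; last exact: measurable_mx_adj.
  by apply: measurable_funV; exact: measurable_det.
by apply/funext => w; rewrite /invmx uA.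
Qed.

(** Regularization replaces the generalized inverse, whose entries are defined
    by pivoting, by a pointwise limit of rational functions of the entries. *)
Lemma measurable_smoother n p (K : T -> 'M[R]_n) (S : T -> 'M[R]_(p, n)) lam :
  0 < lam -> (forall w, psd (K w)) -> measurable_mx K -> measurable_mx S ->
  measurable_mx (fun w => smoother (K w) (S w) lam).
Proof.
move=> lam0 pK mK mS i j.
apply: (@measurable_fun_cvg _ _ _ _
  (fun k w => ridged_smoother (K w) (S w) lam k.+1%:R^-1 i j)); last first.
  by move=> w _; exact: cvg_ridged_smoother.
move=> k; rewrite /ridged_smoother; move: i j; rewrite -/(measurable_mx _).
have mSt := measurable_mx_tr mS.
do 2 ![apply: measurable_mx_mul => //].
apply: measurable_mx_mul; first exact: measurable_mx_mul.
apply: measurable_mx_inv => [w|]; first exact: unitmx_ridge.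
apply: measurable_mx_add; last exact: measurable_mx_cst.
apply: measurable_mx_add.
  by do 3 ![apply: measurable_mx_mul => //].
apply: measurable_mx_scale => //.
by do 3 ![apply: measurable_mx_mul => //].
Qed.

End measurable_matrices.

(** * Products of independent random variables *)

Section independence.
Context {R : realType} {d : measure_display} {W : measurableType d}.
Variable P : probability W R.
Local Open Scope ereal_scope.

(** The joint law of U and V is the product of their laws, so Fubini applies. *)
Lemma product_expectation (U V : {RV P >-> R}) :
  (forall A B, measurable A -> measurable B ->
     P (U @^-1` A `&` V @^-1` B) = P (U @^-1` A) * P (V @^-1` B)) ->
  P.-integrable setT (EFin \o U) -> P.-integrable setT (EFin \o V) ->
  P.-integrable setT (fun w => (U w * V w)%:E) /\
  \int[P]_w (U w * V w)%:E = \int[P]_w (U w)%:E * \int[P]_w (V w)%:E.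
Proof.
move=> UV iU iV.
have mUV : measurable_fun setT (fun w => (U w, V w)).
  by apply/measurable_fun_pairP; split; exact: measurable_funPT.
pose UVm : {mfun W >-> (R * R)%type} :=
  HB.pack (fun w => (U w, V w)) (isMeasurableFun.Build _ _ _ _ _ mUV).
pose f (z : R * R) := (z.1 * z.2)%:E.
have mf : measurable_fun setT f.
  by apply/measurable_EFinP; apply: measurable_funM.
have E A : measurable A -> (distribution P U \x distribution P V) A = distribution P UVm A.
  by move=> mA; apply: product_measure_unique => // B C mB mC; exact: UV.
have fin (X : {RV P >-> R}) : P.-integrable setT (EFin \o X) ->
    \int[distribution P X]_x `|x%:E| < +oo.
  move=> /integrableP[_]; rewrite ge0_integral_distribution//.
  exact: measurableT_comp.
have iD (X : {RV P >-> R}) : P.-integrable setT (EFin \o X) ->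
    (distribution P X).-integrable setT EFin.
  by move=> iX; apply/integrableP; split => //; exact: fin.
have i2 : (distribution P U \x distribution P V).-integrable setT f.
  apply/integrable12ltyP => //.
  under eq_integral => x _.
    under eq_integral => y _ do rewrite /f EFinM abseM /=.
    rewrite ge0_integralZl//; last exact: measurableT_comp.
    over.
  rewrite /= ge0_integralZr//.
  - rewrite lte_mul_pinfty ?fin// ?ge0_fin_numE ?fin//.
      by apply: integral_ge0.
    by apply: integral_ge0.
  - exact: measurableT_comp.
  - exact: integral_ge0.
have iUV : P.-integrable setT (f \o UVm).
  apply/integrableP; split.
    by apply: measurableT_comp => //; exact: measurable_funPT.
  have /integrableP[_] := i2.
  rewrite (eq_measure_integral (distribution P UVm)) => [|A mA _]; last exact: E.
  by rewrite ge0_integral_distribution//; exact: measurableT_comp.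
split => //.
transitivity (\int[distribution P UVm]_z f z); first by rewrite integral_distribution.
transitivity (\int[distribution P U \x distribution P V]_z f z).
  by apply: eq_measure_integral => A mA _; exact/esym/E.
rewrite -integral12_prod_meas1//.
transitivity (\int[distribution P U]_x (x%:E * \int[distribution P V]_y y%:E)).
  by apply: eq_integral => x _; rewrite -integralZl//; exact: iD.
have iDf (X : {RV P >-> R}) : P.-integrable setT (EFin \o X) ->
    \int[distribution P X]_x x%:E = \int[P]_w (X w)%:E.
  by move=> iX; rewrite integral_distribution.
rewrite !iDf//.
have /fineK <- : \int[P]_w (V w)%:E \is a fin_num by exact: integrable_fin_num.
by rewrite integralZr ?iDf//; exact: iD.
Qed.

End independence.

(** * Moments of the standard normal law *)

Section normal_moments.
Context {R : realType}.
Local Notation mu := (@lebesgue_measure R).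
Local Notation N01 := (normal_prob (0 : R) 1).
Local Open Scope ereal_scope.

(** The normal density is almost everywhere the Radon-Nikodym derivative of
    [normal_prob]. *)
Lemma ge0_integral_normal_prob (m s : R) (f : R -> \bar R) :
  (forall x, 0 <= f x) -> measurable_fun setT f ->
  \int[normal_prob m s]_x f x = \int[mu]_x (f x * (normal_pdf m s x)%:E).
Proof.
move=> f0 mf; have dom := normal_prob_dominates m s.
rewrite -(Radon_Nikodym_SigmaFinite.change_of_variables dom)//.
have mpdf : measurable_fun setT (fun x => (normal_pdf m s x)%:E).
  by apply/measurable_EFinP; exact: measurable_normal_pdf.
have iRN := Radon_Nikodym_SigmaFinite.f_integrable dom.
apply: ae_eq_integral => //.
- by apply: emeasurable_funM => //; exact: measurable_int iRN.
- exact: emeasurable_funM.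
- apply: ae_eqe_mul2l; apply: integral_ae_eq => // E _ mE.
  by rewrite -Radon_Nikodym_SigmaFinite.f_integral.
Qed.

(** Half of the exponent pays for the square: x^2 exp (- x^2 / 4) <= 4, and the
    other half is, up to a constant, the normal density of variance 2. *)
Lemma normal_second_moment : \int[N01]_x (x ^+ 2)%:E < +oo.
Proof.
rewrite ge0_integral_normal_prob//; last 2 first.
- by move=> x; rewrite lee_fin sqr_ge0.
- by apply/measurable_EFinP; exact: measurable_funX.
pose s : R := Num.sqrt 2; have s0 : (s != 0)%R by rewrite sqrtr_eq0 -ltNge.
have s2 : (s ^+ 2 = 2)%R by rewrite sqr_sqrtr.
pose C := (4 * normal_peak 1 / normal_peak s)%R.
have C0 : (0 <= C)%R by rewrite !mulr_ge0 ?invr_ge0 ?normal_peak_ge0.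
have le1 x : ((x ^+ 2) * normal_pdf 0 1 x <= C * normal_pdf 0 s x)%R.
  rewrite !normal_pdfE ?oner_neq0// /normal_fun !subr0 s2 expr1n.
  rewrite /C mulrCA -!mulrA [leRHS]mulrCA.
  rewrite (mulrA (normal_peak s)^-1%R) mulVf ?gt_eqF ?normal_peak_gt0// mul1r.
  rewrite ler_wpM2l ?normal_peak_ge0//.
  have -> : (- x ^+ 2 / (1 *+ 2) = - x ^+ 2 / 4 + - x ^+ 2 / 4)%R by field.
  have -> : (- x ^+ 2 / (2 *+ 2) = - x ^+ 2 / 4)%R by field.

  rewrite expRD !mulrA -expr2 ler_wpM2r ?expR_ge0//.
  have /ltW h := expR_gt0 (- x ^+ 2 / 4)%R.
  have := expR_ge1Dx (x ^+ 2 / 4)%R.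
  have : (expR (x ^+ 2 / 4) * expR (- x ^+ 2 / 4) = 1)%R.
    by rewrite -expRD mulNr subrr expR0.
  nra.
apply: (@le_lt_trans _ _ (\int[mu]_x (C%:E * (normal_pdf 0 s x)%:E))).
  apply: ge0_le_integral => //.
  - by move=> x _; rewrite mule_ge0// lee_fin ?sqr_ge0 ?normal_pdf_ge0.
  - apply: emeasurable_funM; apply/measurable_EFinP; first exact: measurable_funX.
    exact: measurable_normal_pdf.
  - apply: emeasurable_funM => //; apply/measurable_EFinP; exact: measurable_normal_pdf.
  - by move=> x _; rewrite -!EFinM lee_fin le1.
rewrite ge0_integralZl//.
- by rewrite integral_normal_pdf mule1 ltry.
- by apply/measurable_EFinP; exact: measurable_normal_pdf.
- by move=> x _; rewrite lee_fin normal_pdf_ge0.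
Qed.

Let measurable_opp : measurable_fun [set: measurableTypeR R]
  (-%R : measurableTypeR R -> measurableTypeR R).
Proof. exact: oppr_measurable. Qed.

Let opp_mfun : {mfun measurableTypeR R >-> measurableTypeR R} :=
  HB.pack (-%R : R -> R) (isMeasurableFun.Build _ _ _ _ _ measurable_opp).

Lemma lebesgue_measure_opp (A : set R) : measurable A ->
  mu (-%R @^-1` A) = mu A.
Proof.
move=> mA; apply/esym.
apply: (@lebesgue_measure_unique _ (pushforward mu opp_mfun)) => // _ [[a b] _ <-] /=.
rewrite /pushforward /= (_ : _ @^-1` _ = `[(- b)%R, (- a)%R[%classic).
  rewrite !lebesgue_measure_itv/= !lte_fin ltrN2; case: ifPn => // _.
  by rewrite -!EFinB opprK addrC.
by apply/seteqP; split => x /=; rewrite !in_itv/=; lra.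
Qed.

Lemma normal_prob_opp (A : set R) : measurable A -> N01 (-%R @^-1` A) = N01 A.
Proof.
move=> mA; rewrite /normal_prob.
have pdfN x : normal_pdf (0 : R) 1 (- x) = normal_pdf 0 1 x.
  by rewrite !normal_pdfE ?oner_neq0// /normal_fun !subr0 sqrrN.
transitivity (\int[pushforward mu opp_mfun]_(x in A) (normal_pdf 0 1 x)%:E).
  rewrite (ge0_integral_pushforward (phi := opp_mfun))//.
  - by apply: eq_integral => x _ /=; rewrite pdfN.
  - by apply/measurable_EFinP/measurable_funTS; exact: measurable_normal_pdf.
  - by move=> x _; rewrite lee_fin normal_pdf_ge0.
by apply: eq_measure_integral => B mB _; exact: lebesgue_measure_opp.
Qed.

(** The law is invariant under x |-> - x. *)
Lemma normal_first_moment : N01.-integrable setT EFin /\ \int[N01]_x x%:E = 0.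
Proof.
have iN : N01.-integrable setT EFin.
  apply/integrableP; split => //.
  have h : \int[N01]_x (1 + x ^+ 2)%:E < +oo.
    under eq_integral do rewrite EFinD.
    rewrite ge0_integralD//.
    - rewrite integral_cst// mul1e.
      rewrite [X in X + _](_ : _ = 1); last exact: (probability_setT N01).
      by rewrite lte_add_pinfty// ?ltry//; exact: normal_second_moment.
    - by move=> x _; rewrite lee_fin sqr_ge0.
    - by apply/measurable_EFinP; exact: measurable_funX.
  apply: le_lt_trans h; apply: ge0_le_integral => //.
  - exact: measurableT_comp.
  - by apply/measurable_EFinP; apply: measurable_funD => //; exact: measurable_funX.
  - move=> x _; rewrite lee_fin.
    have := sqr_ge0 (x - 1)%R; have := sqr_ge0 (x + 1)%R.
    have := sqr_ge0 x; rewrite ler_norml => *; apply/andP; split; nra.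
split => //.
have E : \int[N01]_x x%:E = - \int[N01]_x x%:E.
  transitivity (\int[pushforward N01 opp_mfun]_x x%:E).
    by apply: eq_measure_integral => B mB _; exact/esym/normal_prob_opp.
  have iNN : N01.-integrable setT (EFin \o opp_mfun).
    rewrite (_ : _ \o _ = \- EFin); first exact: integrableN.
    by apply/funext => x.
  rewrite (integral_pushforward (phi := opp_mfun))//.
  rewrite -integralN; last exact/integrable_add_def.
  by apply: eq_integral.
have /fineK F : \int[N01]_x x%:E \is a fin_num by exact: integrable_fin_num.
move: E; rewrite -F => -[] E; congr EFin; move: E; lra.
Qed.

End normal_moments.

(** * Quadratic forms of the noise *)

Section noise.
Context {R : realType} {d : measure_display} {W : measurableType d}.
Variable P : probability W R.
Local Notation N01 := (normal_prob (0 : R) 1).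
Local Open Scope ereal_scope.

(** Only the finiteness of the second moment matters for the rate, so it is kept
    as a constant. *)
Definition normal_m2 : R := fine (\int[N01]_x (x ^+ 2)%:E).

Lemma normal_m2_ge0 : (0 <= normal_m2)%R.
Proof. by apply: fine_ge0; apply: integral_ge0 => x _; rewrite lee_fin sqr_ge0. Qed.

Lemma normal_RV_moments (X : {RV P >-> R}) :
  (forall A, measurable A -> P (X @^-1` A) = N01 A) ->
  [/\ P.-integrable setT (EFin \o X), \int[P]_w (X w)%:E = 0,
      P.-integrable setT (fun w => (X w * X w)%:E) &
      \int[P]_w (X w * X w)%:E = normal_m2%:E].
Proof.
move=> XN.
have mX : measurable_fun setT (X : W -> measurableTypeR R).
  by move=> mD B mB; apply: (measurable_funPT X mD).
(* [normal_prob] is a measure on [measurableTypeR R]; X is viewed with values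
   in that copy of the real line. *)
pose Y : {mfun W >-> measurableTypeR R} :=
  HB.pack (X : W -> R) (isMeasurableFun.Build _ _ _ _ _ mX).
have EY (f : R -> \bar R) : \int[pushforward P Y]_x f x = \int[N01]_x f x.
  by apply: eq_measure_integral => B mB _; exact: XN.
have [iN N0] := @normal_first_moment R.
have mabs : measurable_fun setT (fun x : measurableTypeR R => `|x%:E|).
  exact: measurableT_comp.
have msq : measurable_fun setT (fun x : measurableTypeR R => (x ^+ 2)%:E).
  by apply/measurable_EFinP; exact: measurable_funX.
have iX : P.-integrable setT (EFin \o X).
  apply/integrableP; split; first exact/measurable_EFinP.
  move/integrableP : iN => [_]; rewrite -EY.
  by rewrite (ge0_integral_pushforward (phi := Y)).
have sqE : \int[P]_w (X w * X w)%:E = \int[N01]_x (x ^+ 2)%:E.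
  rewrite -EY (ge0_integral_pushforward (phi := Y))//.
  by move=> x _; rewrite lee_fin sqr_ge0.
have m2E : \int[N01]_x (x ^+ 2)%:E = normal_m2%:E.
  rewrite /normal_m2 fineK// ge0_fin_numE ?normal_second_moment//.
  by apply: integral_ge0 => x _; rewrite lee_fin sqr_ge0.
split => //.
- by rewrite -N0 -EY (integral_pushforward (phi := Y)).
- apply/integrableP; split; first by apply/measurable_EFinP; exact: measurable_funM.
  under eq_integral do rewrite gee0_abs ?lee_fin -?expr2 ?sqr_ge0//.
  under eq_integral do rewrite expr2.
  by rewrite sqE normal_second_moment.
- by rewrite sqE m2E.
Qed.

Section quadratic.
Variables (n : nat) (eps : 'I_n -> {RV P >-> R}) (A : W -> 'M[R]_n).
Variables (F G : set (set W)).
Hypothesis heps : iid_from P eps N01.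
Hypothesis Feps : forall i j B, measurable B -> F ((fun w => (eps i w * eps j w)%R) @^-1` B).
Hypothesis GA : forall i j B, measurable B -> G ((fun w => A w i j) @^-1` B).
Hypothesis mA : measurable_mx A.
Hypothesis FG : indep_systems P F G.
Hypothesis A1 : forall i j w, (`|A w i j| <= 1)%R.

Let epsN i B : measurable B -> P (eps i @^-1` B) = N01 B := heps.1 i B.

(** Two distinct noise variables are independent: take the whole line for the
    other events in the product rule. *)
Lemma noise_products i j :
  P.-integrable setT (fun w => (eps i w * eps j w)%:E) /\
  \int[P]_w (eps i w * eps j w)%:E = ((i == j)%:R * normal_m2)%:E.
Proof.
have [i1 e1 i2 e2] := normal_RV_moments (epsN i).
have [j1 f1 _ _] := normal_RV_moments (epsN j).
have [<-|ij] := eqVneq i j; first by rewrite mul1r.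
rewrite mul0r.
have [] := product_expectation _ i1 j1; last by rewrite e1 mul0e.
move=> B C mB mC.
pose D k := if k == i then B else if k == j then C else setT.
have mD k : measurable (D k) by rewrite /D; do 2 case: ifPn => //.
have -> : eps i @^-1` B `&` eps j @^-1` C = \bigcap_k (eps k @^-1` D k).
  apply/seteqP; split=> [w [Bw Cw] k _|w Dw]; rewrite /= ?/D.
    by case: eqVneq => [->//|_]; case: eqVneq => [->//|_].
  split; first by have := Dw i I; rewrite /D/= eqxx.
  by have := Dw j I; rewrite /D/= eq_sym (negbTE ij) eqxx.
rewrite heps.2// (bigD1 i)//= (bigD1 j) ?(eq_sym j) //= big1 => [|k /andP[ki kj]].
  by rewrite mule1 /D eqxx eq_sym (negbTE ij) eqxx.
by rewrite /D (negbTE ki) (negbTE kj) preimage_setT probability_setT.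
Qed.

Local Notation q := (fun w => dot (\col_i eps i w) (A w *m \col_i eps i w)).

(** Off-diagonal terms vanish because the noise is centred, independent across
    indices and independent of A. *)
Lemma expectation_quad :
  P.-integrable setT (fun w => (q w)%:E) /\
  \int[P]_w (q w)%:E = normal_m2%:E * \int[P]_w (\tr (A w))%:E.
Proof.
have qE w : (q w)%:E = \sum_i \sum_j (A w i j * (eps i w * eps j w))%:E.
  rewrite dotE -sumEFin; apply: eq_bigr => i _.
  rewrite sumEFin !mxE mulr_sumr; congr EFin; apply: eq_bigr => j _.
  by rewrite !mxE; ring.
have iA i j : P.-integrable setT (fun w => (A w i j)%:E).
  apply: (@le_integrable _ _ _ _ _ _ _ (cst 1)) => //.
  - by apply/measurable_EFinP; exact: mA.
  - by move=> w _; rewrite abse1 lee_fin A1.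
  - exact: finite_measure_integrable_cst.
have term i j : P.-integrable setT (fun w => (A w i j * (eps i w * eps j w))%:E) /\
    \int[P]_w (A w i j * (eps i w * eps j w))%:E =
    \int[P]_w (A w i j)%:E * ((i == j)%:R * normal_m2)%:E.
  pose U : {RV P >-> R} := HB.pack (fun w => A w i j)
    (isMeasurableFun.Build _ _ _ _ _ (mA i j)).
  have mV : measurable_fun setT (fun w => (eps i w * eps j w)%R).
    exact: measurable_funM.
  pose V : {RV P >-> R} := HB.pack (fun w => (eps i w * eps j w)%R)
    (isMeasurableFun.Build _ _ _ _ _ mV).
  have [iV eV] := noise_products i j; rewrite -eV.
  apply: (@product_expectation _ _ _ P U V); [|exact: iA|exact: iV].
  move=> B C mB mC; have := FG (Feps i j mC) (GA i j mB).
  by rewrite setIC muleC.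
split.
  under eq_fun do rewrite qE.
  apply: integrable_sum => // i _; apply: integrable_sum => // j _.
  by have [] := term i j.
under eq_integral do rewrite qE.
rewrite integral_sum//; last first.
  by move=> i; apply: integrable_sum => // j _; have [] := term i j.
under [in RHS]eq_integral do rewrite /mxtrace -sumEFin.
rewrite [in RHS]integral_sum//.
have aE i j : \int[P]_w (A w i j)%:E = (fine (\int[P]_w (A w i j)%:E))%:E.
  by rewrite fineK//; exact: integrable_fin_num.
under [in RHS]eq_bigr do rewrite aE.
rewrite sumEFin -EFinM mulr_sumr -sumEFin; apply: eq_bigr => i _.
rewrite integral_sum//; last by move=> j; have [] := term i j.
rewrite (bigD1 i)//= big1 ?adde0 => [|j /negbTE ji].
  by have [_ ->] := term i i; rewrite eqxx mul1r aE -EFinM mulrC.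
by have [_ ->] := term i j; rewrite eq_sym ji mul0r mule0.
Qed.

Lemma quad_tail_prob (t M : R) : (0 < M)%R ->
  (forall w v, 0 <= dot v (A w *m v))%R -> (forall w, \tr (A w) <= t)%R ->
  P [set w | (M < q w)%R] <= (normal_m2 * t / M)%:E.
Proof.
move=> M0 A0 At; have [iq qE] := expectation_quad.
have mq : measurable_fun setT q by apply/measurable_EFinP; exact: measurable_int iq.
pose X : {RV P >-> R} := HB.pack q (isMeasurableFun.Build _ _ _ _ _ mq).
have q0 w : (0 <= q w)%R by exact: A0.
have := @markov _ _ _ P X id M M0; rewrite unlock /= => mk.
rewrite EFinM lee_pdivlMr//.
apply: (@le_trans _ _ (\int[P]_w `|q w|%:E)).
  rewrite muleC; apply: le_trans (mk _ _ _) => //.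
  rewrite lee_wpmul2l ?lee_fin ?(ltW M0)// le_measure ?inE//.
  - rewrite (_ : [set _ | _] = setT `&` q @^-1` `]M, +oo[).
      exact: mq measurableT _ (measurable_itv _).
    by rewrite setTI; apply/seteqP; split => w /=; rewrite in_itv/= andbT.
  - rewrite (_ : [set _ | _] = setT `&` q @^-1` `[M, +oo[).
      exact: mq measurableT _ (measurable_itv _).
    rewrite setTI; apply/seteqP; split => w /=;
      by rewrite in_itv/= andbT lee_fin ger0_norm.
  - by move=> w /= /ltW; rewrite lee_fin ger0_norm.
under eq_integral do rewrite ger0_norm//.
rewrite qE EFinM lee_wpmul2l ?lee_fin ?normal_m2_ge0//.
apply: (@le_trans _ _ (\int[P]_w t%:E)).
  apply: ge0_le_integral => //.
  - by move=> w _; rewrite lee_fin mxtrace_dot sumr_ge0// => i _; exact: A0.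
  - by apply/measurable_EFinP; apply: measurable_sum => i; exact: mA.
  - by move=> w _; rewrite lee_fin At.
by rewrite integral_cst// [X in _ * X](_ : _ = 1) ?mule1//; exact: probability_setT.
Qed.

End quadratic.
End noise.

(** * Kernel matrices of a sample *)

Section rkhs_sample.
Context {R : realType} {dT : measure_display} {T : measurableType dT}.
Variables (X : set T) (K : T -> T -> R) (H : set (T -> R)) (ip : (T -> R) -> (T -> R) -> R).
Hypothesis hH : rkhs X K H ip.
Variables (n : nat) (x : 'I_n -> T).
Hypothesis xX : forall i, X (x i).

Let comb (a : 'cV[R]_n) : T -> R := \sum_i a i 0 *: K (x i).

Lemma rkhs_ip0 f : H f -> ip 0 f = 0.
Proof.
move=> Hf; have H0 := rkhs_0 hH; have := rkhs_ip_lin hH 1 H0 H0 Hf.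
by rewrite scale1r add0r mul1r; lra.
Qed.

Let comb_rkhs a : H (comb a) /\
  forall f, H f -> ip (comb a) f = \sum_i a i 0 * f (x i).
Proof.
rewrite /comb; elim: (index_enum _) => [|i r [Hr IH]].
  by rewrite big_nil; split; [exact: rkhs_0 hH|move=> f Hf; rewrite big_nil rkhs_ip0].
have Hi := rkhs_kernel hH (xX i).
rewrite !big_cons; split; first exact: rkhs_lin hH _ _ _ _ _.
move=> f Hf; rewrite (rkhs_ip_lin hH)// IH// big_cons (rkhs_ip_sym hH)//.
by rewrite (rkhs_reproducing hH).
Qed.

Let kernel_sym i j : K (x i) (x j) = K (x j) (x i).
Proof.
have Hx k := rkhs_kernel hH (xX k).
by rewrite -(rkhs_reproducing hH (Hx i) (xX j)) (rkhs_ip_sym hH)// (rkhs_reproducing hH).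
Qed.

Let comb_norm a : (0 < n)%N -> ip (comb a) (comb a) = n%:R * dot a (kernel_mx K x *m a).
Proof.
move=> n0; have [Ha ->//] := comb_rkhs a; rewrite dotE mulr_sumr; apply: eq_bigr => i _.
rewrite mulrCA; congr (_ * _); rewrite /comb fct_sumE mxE mulr_sumr.
apply: eq_bigr => j _; rewrite mxE !mulrA mulfV ?mul1r ?pnatr_eq0 -?lt0n//.
by rewrite mulrC kernel_sym.
Qed.

Lemma psd_kernel_mx : psd (kernel_mx K x).
Proof.
split.
  by apply/matrixP => i j; rewrite !mxE kernel_sym.
move=> v; case: (posnP n) => [n0|n0].
  by rewrite dotE big1// => -[i iN]; exfalso; rewrite n0 in iN.
rewrite -(@pmulr_rge0 _ n%:R) ?ltr0n// -comb_norm//.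
by apply: rkhs_ip_ge0 hH _ _; have [] := comb_rkhs v.
Qed.

(** By the reproducing property a^T f is the inner product of f0 with the sum of
    the a_i K(x_i, .), whose squared norm is n a^T K a. *)
Lemma rkhs_evaluation f0 a : (0 < n)%N -> H f0 ->
  dot a (\col_i f0 (x i)) ^+ 2 <=
  (n%:R * ip f0 f0) * dot a (kernel_mx K x *m a).
Proof.
move=> n0 Hf; have [Ha E] := comb_rkhs a.
have -> : dot a (\col_i f0 (x i)) = ip (comb a) f0.
  by rewrite E// dotE; apply: eq_bigr => i _; rewrite mxE.
rewrite mulrAC -comb_norm//; apply: quad_discr => t.
have Hs : H (t *: f0 + comb a) by exact: rkhs_lin hH _ _ _ _ _.
have := rkhs_ip_ge0 hH Hs.
rewrite (rkhs_ip_lin hH)// (rkhs_ip_sym hH _ Hs)// (rkhs_ip_lin hH)//.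
rewrite (rkhs_ip_sym hH Ha Hs) (rkhs_ip_lin hH)// (rkhs_ip_sym hH Hf Ha).
by congr (0 <= _); ring.
Qed.

End rkhs_sample.

Section error_decomposition.
Context {R : realType} {T : Type}.
Variables (K : T -> T -> R) (n p : nat) (lam : R) (S : 'M[R]_(p, n)) (x : 'I_n -> T).

Local Notation Kx := (kernel_mx K x).
Local Notation A := (smoother Kx S lam).

Lemma f_hat_smoother (y : 'cV[R]_n) : (0 < n)%N ->
  \col_i f_hat K lam S x y (x i) = A *m y.
Proof.
move=> n0; apply/matrixP => i j; rewrite ord1 mxE /f_hat.
rewrite smootherE /sketch_coef [RHS]mxE; apply: eq_bigr => k _.
rewrite /beta_hat -/(sketched_normal_mx Kx S lam) -scalemxAr.
rewrite -mulmxA [X in X * _]mxE [Kx i k]mxE. ring.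
Qed.

Lemma emp_norm2_smoother (f0 : T -> R) (e : 'I_n -> R) : (0 < n)%N ->
  let f := \col_i f0 (x i) in
  emp_norm2 x (fun z => f_hat K lam S x (\col_i (f0 (x i) + e i)) z - f0 z) =
  n%:R^-1 * dot (A *m (f + \col_i e i) - f) (A *m (f + \col_i e i) - f).
Proof.
move=> n0; cbv zeta; rewrite /emp_norm2.
have -> : \col_i (f0 (x i) + e i) = \col_i f0 (x i) + \col_i e i.
  by apply/matrixP => k l; rewrite !mxE.
rewrite -f_hat_smoother// dotE; congr (_ * _); apply: eq_bigr => i _.
by rewrite !mxE expr2.
Qed.

(** Here |A f - f + A e|^2 <= 2 |A f - f|^2 + 2 |A e|^2 and |A e|^2 <= e^T A e. *)
Lemma emp_error_le (f0 : T -> R) (e : 'I_n -> R) (B : R) : (0 < n)%N ->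
  psd Kx -> 0 < lam ->
  let f := \col_i f0 (x i) in
  (exists b, dot (Kx *m (S^T *m b) - f) (Kx *m (S^T *m b) - f) +
    lam * dot (S^T *m b) (Kx *m (S^T *m b)) <= B) ->
  emp_norm2 x (fun z => f_hat K lam S x (\col_i (f0 (x i) + e i)) z - f0 z) <=
  n%:R^-1 * ((B + dot (\col_i e i) (A *m \col_i e i)) *+ 2).
Proof.
move=> n0 pK lam0; cbv zeta; set f := \col_i f0 _; set v := \col_i e i => -[b hb].
rewrite emp_norm2_smoother// -/f -/v ler_wpM2l ?invr_ge0//.
have := le_trans (smoother_bias S pK lam0 f b) hb.
have := smoother_sq_le S pK lam0 v; rewrite mulmxDr addrAC.
move: (A *m f - f) (A *m v) => s t; have := dotvv_ge0 (s - t).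
by rewrite !dot_lin (dotC t s); lra.
Qed.

End error_decomposition.

Section smoother_trace.
Context {R : realType} {dT : measure_display} {T : measurableType dT}.
Variables (X : set T) (PX : probability T R) (K : T -> T -> R) (H : set (T -> R)).
Variables (ip : (T -> R) -> (T -> R) -> R) (mu : nat -> R) (phi : nat -> T -> R).
Hypothesis hH : rkhs X K H ip.
Hypothesis hK : eigen_system X PX K H ip mu phi.
Variable M : R.
Hypothesis hM : forall i z, X z -> `|phi i z| <= M.

(** Deterministic counterpart of the effective dimension bound: it holds for
    every sample in X and every sketch S. *)
Lemma mxtrace_smoother_le (n p N : nat) (x : 'I_n -> T) (S : 'M[R]_(p, n)) (lam t : R) :
  (0 < n)%N -> (forall i, X (x i)) -> 0 < lam ->
  (\sum_(N <= i <oo) (mu i)%:E <= t%:E)%E ->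
  lam * \tr (smoother (kernel_mx K x) S lam) <= lam * N%:R + M ^+ 2 * t.
Proof.
move=> n0 xX lam0 tailN; have pK := psd_kernel_mx hH xX.
have n0' : (0 : R) < n%:R by rewrite ltr0n.
pose v k : 'cV[R]_n := \col_i phi k (x i).
pose V := \matrix_(i < n, k < N) v k i 0.
apply: le_trans (mxtrace_le_projector V (ltW lam0) (smoother_le1 S pK lam0)
  (smoother_leK S pK lam0)) _.
rewrite lerD2l.
have -> : M ^+ 2 * t = (n%:R * M ^+ 2) * (t / n%:R) by field; rewrite gt_eqF.
apply: (mxtrace_feature_tail (mu := fun k => mu k / n%:R)).
- by move=> k; rewrite divr_ge0 ?(eigen_ge0 hK)// ltW.
- by rewrite mulr_ge0 ?sqr_ge0 ?ltW.
- move=> i j; rewrite mxE.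
  have -> : series (fun k => mu k / n%:R * v k i 0 * v k j 0) =
      (fun L => n%:R^-1 * series (fun k => mu k * phi k (x i) * phi k (x j)) L).
    apply/funext => L; rewrite /series /= mulr_sumr; apply: eq_bigr => k _.
    by rewrite !mxE; ring.
  by apply: cvgMl_tmp; exact: eigen_kernel hK _ _ _ _.
- move=> k; rewrite dotE; apply: (@le_trans _ _ (\sum_(i < n) M ^+ 2)).
    apply: ler_sum => i _; rewrite !mxE -expr2 -[_ ^+ 2]real_normK ?num_real//.
    have := hM k (xX i); have := normr_ge0 (phi k (x i)).
    by move=> h0 h1; rewrite lerXn2r ?nnegrE//; exact: le_trans h1.
  by rewrite sumr_const card_ord mulr_natl.
- move=> L; rewrite -mulr_suml ler_wpM2r ?invr_ge0 ?(ltW n0')//.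
  rewrite -lee_fin; apply: le_trans tailN; rewrite -sumEFin.
  have [LN|NL] := leqP L N.
    rewrite big_geq//; apply: nneseries_ge0 => k _ _; rewrite lee_fin; exact: eigen_ge0 hK k.
  apply: nneseries_lim_ge => k _ _; rewrite lee_fin; exact: eigen_ge0 hK k.
Qed.

End smoother_trace.

(** * Measurability and probability of the events *)

Section measurable_kernels.
Context {R : realType} {dT : measure_display} {T : measurableType dT}.
Variables (X : set T) (PX : probability T R) (K : T -> T -> R) (H : set (T -> R)).
Variables (ip : (T -> R) -> (T -> R) -> R) (mu : nat -> R) (phi : nat -> T -> R).
Hypothesis hK : eigen_system X PX K H ip mu phi.

Lemma Lfun_measurable (f : T -> R) p : f \in Lfun PX p -> measurable_fun setT f.
Proof. by move=> /sub_Lfun_mfun; rewrite inE. Qed.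

Lemma measurable_kernel d' (W : measurableType d') (u v : W -> T) :
  measurable_fun setT u -> measurable_fun setT v ->
  (forall w, X (u w)) -> (forall w, X (v w)) ->
  measurable_fun setT (fun w => K (u w) (v w)).
Proof.
move=> mu' mv uX vX.
apply: (@measurable_fun_cvg _ _ _ _
  (fun L w => series (fun k => mu k * phi k (u w) * phi k (v w)) L)); last first.
  by move=> w _; exact: eigen_kernel hK _ _ (uX w) (vX w).
move=> L; apply: measurable_sum => k.
have mphi := Lfun_measurable (eigen_L2 hK k).
apply: measurable_funM; last exact: measurableT_comp.
by apply: measurable_funM => //; exact: measurableT_comp.
Qed.

Lemma measurable_kernel_mx d' (W : measurableType d') n (x : 'I_n -> W -> T) :
  (forall i, measurable_fun setT (x i)) -> (forall i w, X (x i w)) ->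
  measurable_mx (fun w => kernel_mx K (fun i => x i w)).
Proof.
move=> mx xX i j; under eq_fun do rewrite mxE.
by apply: measurable_funM => //; exact: measurable_kernel.
Qed.

End measurable_kernels.

Section generated_sigma_algebras.
Context {R : realType} {d : measure_display} {W : measurableType d}.

Lemma g_sigma_preimage_in dT (T : measurableType dT) n (f : 'I_n -> W -> T) i B :
  measurable B -> g_sigma_preimage f (f i @^-1` B).
Proof.
move=> mB; apply: sub_sigma_algebra; rewrite -bigcup_seq.
exists i; first by rewrite /= mem_index_enum.
by exists B => //; rewrite setTI.
Qed.

Lemma g_sigma_preimage_measurable dT (T : measurableType dT) n (f : 'I_n -> W -> T) :
  (forall i, measurable_fun setT (f i)) -> g_sigma_preimage f `<=` measurable.
Proof.
move=> mf; apply: smallest_sub; first exact: sigma_algebra_measurable.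
rewrite -bigcup_seq => A [i _ [B mB <-]]; exact: mf.
Qed.

Lemma sigma_mx_in p q (S : W -> 'M[R]_(p, q)) i j B :
  measurable B -> sigma_mx S ((fun w => S w i j) @^-1` B).
Proof.
move=> mB; apply: sub_sigma_algebra; exists i => //; exists j => //.
by exists B => //; rewrite setTI.
Qed.

End generated_sigma_algebras.

Section ab_type_event.
Context {R : realType} {d : measure_display} {W : measurableType d}.
Variable P : probability W R.
Local Open Scope ereal_scope.

(** Integrating the conditional probability over the event that it is at least
    1 - e, which belongs to G, gives P(E) >= (1 - e)^2. *)
Lemma ab_type_prob (G : set (set W)) (E : set W) (a b : \bar R) (e : R) :
  G `<=` measurable -> (e <= 1)%R -> expeR (- a) <= e%:E -> expeR (- b) <= e%:E ->
  ab_type P G E a b -> P (~` E) <= (e *+ 2)%:E.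
Proof.
move=> GM e1 ea eb [_ _ mE [g [Gg ig cg] hg]].
pose r : R := (1 - e)%R.
pose B := g @^-1` `[r, +oo[.
have GB : G B by exact: Gg (measurable_itv _).
have mB : measurable B := GM _ GB.
have mg : measurable_fun setT g.
  by move=> _ C mC; rewrite setTI; apply: GM; exact: Gg.
have PB : r%:E <= P B.
  apply: (@le_trans _ _ (1 - expeR (- b))).
    by rewrite /r EFinB leeB.
  apply: le_trans hg _; rewrite le_measure ?inE//.
    rewrite -[X in measurable X]setTI; apply: emeasurable_fun_le => //.
    exact/measurable_EFinP.
  move=> w /= hw; rewrite /B /= in_itv/= andbT -lee_fin; apply: le_trans hw.
  by rewrite /r EFinB leeB.
have PE : (r * r)%:E <= P E.
  apply: (@le_trans _ _ (P (E `&` B))); last first.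
    by rewrite le_measure ?inE//; exact: measurableI.
  rewrite -cg//; apply: (@le_trans _ _ (\int[P]_(w in B) r%:E)).
    by rewrite integral_cst// EFinM lee_wpmul2l// lee_fin subr_ge0.
  apply: le_integral => //.
  - exact: finite_measure_integrable_cst.
  - exact: integrableS ig.
  - by move=> w; rewrite inE /B /= in_itv/= andbT lee_fin.
rewrite probability_setC//.
apply: (@le_trans _ _ (1 - (r * r)%:E)); first by rewrite leeB.
by rewrite -EFinB lee_fin /r; have := sqr_ge0 e; lra.
Qed.

End ab_type_event.

Section asymptotics.
Context {R : realType}.

Lemma powRN_small (a e : R) : 0 < a -> 0 < e ->
  \forall n \near \oo, n%:R `^ (- a) < e.
Proof.
move=> a0 e0; near=> n.
have n0 : (0 : R) < n%:R by near: n; exact: nbhs_infty_gtr.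
have h : e^-1 `^ a^-1 < n%:R by near: n; exact: nbhs_infty_gtr.
rewrite powRN -[ltRHS]invrK ltf_pV2 ?posrE ?powR_gt0 ?invr_gt0//.
have -> : e^-1 = (e^-1 `^ a^-1) `^ a.
  by rewrite -powRrM mulVf ?gt_eqF// powRr1 ?invr_ge0 ?ltW.
by rewrite gt0_ltr_powR ?nnegrE ?powR_ge0// ltW.
Unshelve. all: by end_near. Qed.

Lemma ThetaP (f g : nat -> R) : f =Theta_\oo g ->
  exists k1 k2, [/\ 0 < k1, 0 < k2 & \forall n \near \oo,
    k1 * `|g n| <= `|f n| /\ `|f n| <= k2 * `|g n|].
Proof.
rewrite eqThetaE qualifE => /asboolP[[k1 k2] /= /andP[k10 k20] h].
by exists k1, k2.
Qed.

Lemma expeR_small (c : \bar R) (e : R) : (0 < c)%E -> 0 < e ->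
  exists B : R, forall y, B <= y -> (expeR (- (c * y%:E)) <= e%:E)%E.
Proof.
move=> c0 e0; case: c c0 => [c||//].
- rewrite lte_fin => c0; exists (- ln e / c) => y; rewrite ler_pdivrMr// => h.
  rewrite -EFinM /= lee_fin -[leRHS]lnK ?posrE// ler_expR; lra.
- move=> _; exists 1 => y y1; rewrite gt0_mulye ?lte_fin//=; last by lra.
  by rewrite lee_fin ltW.
Qed.

Lemma s_lam_ge (mu : nat -> R) (lam : R) (L : nat) : nonincreasing_seq mu ->
  lam < mu L -> (exists i, mu i <= lam) -> (L <= s_lam mu lam)%N.
Proof.
move=> dmu lamL ex; rewrite /s_lam; case: pselect => // h.
case: ex_minnP => i hi _; rewrite leqNgt; apply/negP => iL.
by have := lt_le_trans lamL (le_trans (dmu _ _ (ltnW iL)) hi); rewrite ltxx.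
Qed.

End asymptotics.

(** * Tail of the error for a fixed sample size *)

Section smoother_entries.
Context {R : realType}.

Lemma smoother_entry_le1 n p (K : 'M[R]_n) (S : 'M[R]_(p, n)) lam i j :
  psd K -> 0 < lam -> `|smoother K S lam i j| <= 1.
Proof.
move=> pK lam0; have pA := psd_smoother S pK lam0.
have le1 k : dot (delta_mx k 0) (smoother K S lam *m delta_mx k 0) <= 1.
  apply: le_trans (smoother_le1 S pK lam0 _) _.
  by rewrite dot_delta mxE !eqxx.
rewrite entry_dot -(@ler_pXn2r _ 2)// ?nnegrE// real_normK ?num_real// expr1n.
apply: le_trans (psd_cauchy _ _ pA) _.
by rewrite mulr_ile1 ?le1//; exact: psd_ge0 pA _.
Qed.

End smoother_entries.

Section sample_bound.
Context {R : realType} {dT : measure_display} {T : measurableType dT}.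
Variables (X : set T) (PX : probability T R) (K : T -> T -> R) (H : set (T -> R)).
Variables (ip : (T -> R) -> (T -> R) -> R) (mu : nat -> R) (phi : nat -> T -> R).
Hypothesis hH : rkhs X K H ip.
Hypothesis hHL2 : forall f, H f -> f \in Lfun PX 2%:E.
Hypothesis hK : eigen_system X PX K H ip mu phi.
Context {dW : measure_display} {W : measurableType dW} (P : probability W R).
Variables (n p : nat) (x : 'I_n -> {RV P >-> T}) (eps : 'I_n -> {RV P >-> R}).
Variables (S : W -> 'M[R]_(p, n)) (lam : R) (f0 : T -> R).
Hypothesis n0 : (0 < n)%N.
Hypothesis xX : forall i w, X (x i w).
Hypothesis heps : iid_from P eps (normal_prob 0 1).
Hypothesis mS : forall i j, measurable_fun setT (fun w => S w i j).
Hypothesis hind : indep_systems P (g_sigma_preimage eps)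
  <<s g_sigma_preimage x `|` sigma_mx S >>.
Hypotheses (lam0 : 0 < lam) (Hf : H f0).

Let Kx w := kernel_mx K (fun i => x i w).
Let A w := smoother (Kx w) (S w) lam.
Let Z w := emp_norm2 (fun i => x i w)
  (fun z => f_hat K lam (S w) (fun i => x i w) (\col_i (f0 (x i w) + eps i w)) z - f0 z).

Let pK w : psd (Kx w) := psd_kernel_mx hH (xX ^~ w).

Let mA : measurable_mx A.
Proof.
by apply: measurable_smoother => //; apply: measurable_kernel_mx hK _ _ _ _ _ _.
Qed.

Lemma measurable_emp_error : measurable_fun setT Z.
Proof.
rewrite /Z; under eq_fun do rewrite emp_norm2_smoother//.
apply: measurable_funM => //.
have mf : measurable_mx (fun w => \col_i f0 (x i w)).
  move=> i j; under eq_fun do rewrite mxE.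
  by apply: measurableT_comp => //; exact: Lfun_measurable (hHL2 Hf).
have me : measurable_mx (fun w => \col_i eps i w).
  by move=> i j; under eq_fun do rewrite mxE; exact: measurable_funPT.
have mv : measurable_mx (fun w => A w *m (\col_i f0 (x i w) + \col_i eps i w)
    - \col_i f0 (x i w)).
  apply: measurable_mx_add.
    by apply: measurable_mx_mul => //; exact: measurable_mx_add.
  by move=> i j; under eq_fun do rewrite mxE; apply: measurable_funN; exact: mf.
by apply: measurable_mx_mul => //; exact: measurable_mx_tr.
Qed.

Let noise_in i j B : measurable B ->
  g_sigma_preimage eps ((fun w => (eps i w * eps j w)%R) @^-1` B).
Proof.
move=> mB.
(* Membership in the generated sigma-algebra is measurability for the
   measurable space that it defines on W. *)
pose W' := g_sigma_algebraType (\big[setU/set0]_(i < n)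
  preimage_set_system setT (eps i) measurable).
have me k : measurable_fun (setT : set W') (eps k).
  by move=> _ C mC; rewrite setTI; exact: g_sigma_preimage_in.
have := measurable_funM (me i) (me j) measurableT mB; rewrite setTI; exact.
Qed.

Let smoother_in i j B : measurable B ->
  <<s g_sigma_preimage x `|` sigma_mx S >> ((fun w => A w i j) @^-1` B).
Proof.
move=> mB.
pose W' := g_sigma_algebraType (g_sigma_preimage x `|` sigma_mx S).
have mx k : measurable_fun (setT : set W') (x k).
  move=> _ C mC; rewrite setTI; apply: sub_sigma_algebra; left.
  exact: g_sigma_preimage_in.
have mS' : measurable_mx (S : W' -> _).
  move=> k l _ C mC; rewrite setTI; apply: sub_sigma_algebra; right.
  exact: sigma_mx_in.
have mK : measurable_mx (Kx : W' -> _).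
  by apply: measurable_kernel_mx hK _ _ _ _ _ _.
have := @measurable_smoother _ _ W' _ _ _ _ _ lam0 pK mK mS' i j measurableT B mB.
by rewrite setTI; exact.
Qed.

(** On the satisfiability event, and where the quadratic form of the noise is at
    most M0, the error is at most tau. *)
Lemma emp_error_tail (c t M0 tau : R) (e : R) :
  (forall w, \tr (A w) <= t) -> 0 < M0 ->
  n%:R^-1 * ((n%:R * ip f0 f0 * lam * (3 + c ^+ 2 *+ 6) + M0) *+ 2) <= tau ->
  measurable [set w | satisfiable c lam (Kx w) (S w)] ->
  (P (~` [set w | satisfiable c lam (Kx w) (S w)]) <= e%:E)%E ->
  (P [set w | (tau < `|Z w|)%R] <= (e + normal_m2 * t / M0)%:E)%E.
Proof.
move=> At M00 htau mE PE.
pose q w := dot (\col_i eps i w) (A w *m \col_i eps i w).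
have A0 w v : 0 <= dot v (A w *m v) := psd_ge0 (psd_smoother (S w) (pK w) lam0) v.
have A1 i j w : `|A w i j| <= 1 by exact: smoother_entry_le1.
have Pq := quad_tail_prob heps noise_in smoother_in mA hind A1 M00 A0 At.
rewrite EFinD; apply: le_trans (leeD PE Pq).
have me : measurable_mx (fun w => \col_i eps i w).
  by move=> i j; under eq_fun do rewrite mxE; exact: measurable_funPT.
have mq : measurable_fun setT q.
  have mAe : measurable_mx (fun w => A w *m \col_i eps i w).
    exact: measurable_mx_mul.
  by apply: measurable_mx_mul => //; exact: measurable_mx_tr.
have mQ : measurable [set w | M0 < q w].
  rewrite (_ : [set _ | _] = setT `&` q @^-1` `]M0, +oo[).
    exact: mq measurableT _ (measurable_itv _).
  by rewrite setTI; apply/seteqP; split => w /=; rewrite in_itv/= andbT.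
apply: le_trans (measureU2 _ _ _) => //; last exact: measurableC.
rewrite le_measure ?inE//.
- have mZ : measurable_fun setT (fun w => `|Z w|).
    by apply: measurableT_comp => //; exact: measurable_emp_error.
  rewrite (_ : [set _ | _] = setT `&` (fun w => `|Z w|) @^-1` `]tau, +oo[).
    exact: mZ measurableT _ (measurable_itv _).
  by rewrite setTI; apply/seteqP; split => w /=; rewrite in_itv/= andbT.
- by apply: measurableU => //; exact: measurableC.
move=> w /= tauZ; have [sat|] := pselect (satisfiable c lam (Kx w) (S w)); last by left.
right; rewrite ltNge; apply/negP => qM0.
move: tauZ; rewrite ltNge => /negP; apply.
have Z0 : 0 <= Z w.
  by rewrite /Z /emp_norm2 mulr_ge0 ?invr_ge0// sumr_ge0// => i _; rewrite sqr_ge0.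
rewrite ger0_norm//; apply: le_trans htau.
have h0 : 0 <= n%:R * ip f0 f0 by rewrite mulr_ge0 ?(rkhs_ip_ge0 hH).
have ev a := rkhs_evaluation hH (xX ^~ w) a n0 Hf.
have [b hb] := satisfiable_approx lam0 h0 ev sat.
apply: le_trans (emp_error_le (fun i => eps i w) n0 (pK w) lam0 _) _.
  by exists b; exact: hb.
by rewrite ler_wpM2l ?invr_ge0// lerMn2r lerD2l.
Qed.

End sample_bound.

(** * Rates *)

Section trace_rate.
Context {R : realType}.
Variables (mu : nat -> R) (m : R).
Hypotheses (mu0 : forall i, 0 <= mu i) (m0 : 0 < m).
Hypothesis hmu : mu =Theta_\oo (fun i => i.+1%:R `^ (- (2 * m))).

Lemma poly_decay_gt0 : nonincreasing_seq mu -> forall L, 0 < mu L.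
Proof.
move=> dmu L; have [k1 [k2 [k10 k20 [N _ hN]]]] := ThetaP hmu.
have LM : (N <= maxn N L)%N by exact: leq_maxl.
have [+ _] := hN _ LM; rewrite !ger0_norm ?powR_ge0// => h.
apply: lt_le_trans (dmu _ _ (leq_maxr N L)); apply: lt_le_trans h.
by rewrite mulr_gt0// powR_gt0.
Qed.

(** In particular the minimum that defines [s_lam] is taken over a nonempty set. *)
Lemma poly_decay_small l : 0 < l -> exists i, mu i <= l.
Proof.
move=> l0; have [k1 [k2 [k10 k20 [N _ hN]]]] := ThetaP hmu.
have m20 : 0 < 2 * m by rewrite mulr_gt0.
have [N' _ hN'] := powRN_small m20 (divr_gt0 l0 k20).
exists (maxn N N'); have [_ +] := hN _ (leq_maxl N N').
rewrite !ger0_norm ?powR_ge0// => h; apply: le_trans h _.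
rewrite mulrC -ler_pdivlMr//; apply: ltW; apply: hN' => /=.
by rewrite (leq_trans (leq_maxr N N')).
Qed.

(** N of order u = n^(1/(2m+1)) balances the two terms of the trace bound: the
    eigenvalue of index u is of the order of the rate r, and u = n r. *)
Lemma rate_balance (n : nat) : (0 < n)%N ->
  let u := n%:R `^ (2 * m + 1)^-1 in
  n%:R `^ (- (2 * m / (2 * m + 1))) = u `^ (- (2 * m)) /\
  n%:R * n%:R `^ (- (2 * m / (2 * m + 1))) = u.
Proof.
move=> n0 u; have n0' : (0 : R) < n%:R by rewrite ltr0n.
have m1 : 2 * m + 1 != 0 by rewrite gt_eqF// addr_gt0// mulr_gt0.
split; first by rewrite /u -powRrM mulrN mulrC.
rewrite -[X in X * _]powRr1 ?ltW// -powRD ?pnatr_eq0 -?lt0n ?n0 ?implybT//.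
by congr (_ `^ _); field.
Qed.

End trace_rate.

Unset Implicit Arguments.
Set Strict Implicit.

Theorem corollary4p8 (R : realType)
  (d : nat) (hd : (0 < d)%N)
  (X : set (d.-tuple R)) (mX : measurable X)
  (PX : probability (d.-tuple R) R) (hPX : PX X = 1%E)
  (K : d.-tuple R -> d.-tuple R -> R) (H : set (d.-tuple R -> R))
  (ip : (d.-tuple R -> R) -> (d.-tuple R -> R) -> R)
  (mu : nat -> R) (phi : nat -> d.-tuple R -> R)
  (hH : rkhs X K H ip)
  (hHL2 : forall f, H f -> f \in Lfun PX 2%:E)
  (hK : eigen_system X PX K H ip mu phi)
  (hA1phi : phi_bounded X phi) (hA1mu : tail_bounded mu)
  (m : R) (hm : 3 / 2 < m)
  (hmu : mu =Theta_\oo (fun i => i.+1%:R `^ (- (2 * m))))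
  (f0 : d.-tuple R -> R) (hf0 : H f0)
  (c : R) (hc : 0 < c)
  (c1 c2 : \bar R) (hc1 : (0 < c1)%E) (hc2 : (0 < c2)%E) :
  exists2 D0 : R, 0 < D0 &
  forall (D : R) (hD : D0 <= D)
    (dW : nat -> measure_display) (W : forall n, measurableType (dW n))
    (P : forall n, probability (W n) R)
    (x : forall n, 'I_n -> {RV (P n) >-> d.-tuple R})
    (hxX : forall n i w, X (x n i w))
    (hx : forall n, iid_from (P n) (x n) PX)
    (eps : forall n, 'I_n -> {RV (P n) >-> R})
    (heps : forall n, iid_from (P n) (eps n) (normal_prob 0 1))
    (s : nat -> nat) (S : forall n, W n -> 'M[R]_(s n, n))
    (mS : forall n i j, measurable_fun setT (fun w => S n w i j))
    (hind : forall n, indep_systems (P n) (g_sigma_preimage (eps n))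
       <<s g_sigma_preimage (x n) `|` sigma_mx (S n) >>)
    (lam : nat -> R) (hlam0 : forall n, 0 < lam n)
    (hlam : lam =Theta_\oo (fun n => n%:R `^ (- (2 * m / (2 * m + 1)))))
    (hA2a : \forall n \near \oo, D * (s_lam mu (lam n))%:R <= (s n)%:R)
    (hA2b : \forall n \near \oo,
       ab_type (P n) (g_sigma_preimage (x n))
         [set w | satisfiable c (lam n) (kernel_mx K (fun i => x n i w)) (S n w)]
         (c1 * (s n)%:R%:E)%E (c2 * (s_lam mu (lam n))%:R%:E)%E),
    bigO_in_probability P
      (fun n w =>
         let xw := fun i => x n i w in
         let y := \col_i (f0 (xw i) + eps n i w) in
         emp_norm2 xw (fun z => f_hat K (lam n) (S n w) xw y z - f0 z))
      (fun n => n%:R `^ (- (2 * m / (2 * m + 1)))).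
Proof.
(* Any bound D >= 1 works: s >= s_lam then forces s to infinity. *)
exists 1; first exact: ltr01.
move=> D hD dW W P x hxX hx eps heps s S mS hind lam hlam0 hlam hA2a hA2b.
have m0 : 0 < m by lra.
have mu0 := eigen_ge0 hK; have dmu := eigen_ordered hK.
have [k1 [k2 [k10 k20 Hmu]]] := ThetaP hmu.
have [l1 [l2 [l10 l20 Hlam]]] := ThetaP hlam.
have [M hM] := hA1phi; have [C hC] := hA1mu.
set a := 2 * m / (2 * m + 1).
have a0 : 0 < a by rewrite /a divr_gt0//; lra.
pose h := ip f0 f0; have h0 : 0 <= h by exact: rkhs_ip_ge0 hH _ hf0.
(* With N = k + 1 terms, mu_k <= (k2 / l1) lam turns the trace bound into N C3. *)
pose C3 := 1 + M ^+ 2 * (`|C| * (k2 / l1)).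
have C30 : 0 <= C3.
  by rewrite addr_ge0// mulr_ge0 ?sqr_ge0// mulr_ge0// divr_ge0// ltW.
move=> e e0.
(* Q makes Markov's inequality cost at most e / 2; failure of satisfiability has
   probability at most 2 e1, which is the other half. *)
pose Q := 4 * normal_m2 * C3 / e + 1.
have Q0 : 0 < Q.
  rewrite /Q ltr_wpDl// divr_ge0 ?(ltW e0)// mulr_ge0// mulr_ge0//.
  exact: normal_m2_ge0.
pose e1 := Num.min (e / 4) 1.
have e10 : 0 < e1 by rewrite lt_min divr_gt0//=.
have e11 : e1 <= 1 by rewrite ge_min lexx orbT.
have e14 : e1 <= e / 4 by rewrite ge_min lexx.
have [B1 hB1] := expeR_small hc1 e10.
have [B2 hB2] := expeR_small hc2 e10.
(* Once s and s_lam exceed L, both exponentials of the type are below e1. *)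
have [L hL] : exists L : nat, B1 <= L%:R /\ B2 <= L%:R.
  exists (Num.truncn (Num.max B1 B2)).+1.
  have := truncnS_gt (Num.max B1 B2); rewrite gt_max => /andP[/ltW ? /ltW ?].
  by split.
have [K0 _ HK0] := Hmu.
exists ((h * l2 * (3 + c ^+ 2 *+ 6) + Q) *+ 2).
have muL := poly_decay_gt0 mu0 hmu dmu L.
have p0 : 0 < (2 * m + 1)^-1 by rewrite invr_gt0; lra.
have K00 : (0 : R) < K0.+1%:R^-1 by rewrite invr_gt0.
near=> n.
have n0 : (0 < n)%N by near: n; exact: nbhs_infty_gt.
have n0' : (0 : R) < n%:R by rewrite ltr0n.
set r := n%:R `^ (- a).
have r0 : 0 < r by exact: powR_gt0.
have [lam1 lam2] : l1 * r <= lam n /\ lam n <= l2 * r.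
  have := hlam0 n; rewrite -/r.
  have : l1 * `|n%:R `^ (- a)| <= `|lam n| /\ `|lam n| <= l2 * `|n%:R `^ (- a)|.
    by near: n; exact: Hlam.
  by rewrite -/r (gtr0_norm r0) => + l0; rewrite (gtr0_norm l0).
have [rE nr] := rate_balance m0 n0; rewrite -/a -/r in rE nr.
set u := n%:R `^ (2 * m + 1)^-1 in rE nr.
have u0 : 0 < u by exact: powR_gt0.
have uK : K0.+1%:R < u.
  have : n%:R `^ (- (2 * m + 1)^-1) < K0.+1%:R^-1.
    by near: n; exact: powRN_small.
  by rewrite powRN -/u ltf_pV2 ?posrE.
have u1 : 1 <= u by apply: le_trans (ltW uK); rewrite ler1n.
pose k := Num.truncn u.
have [uk1 uk2] : k%:R <= u /\ u < k.+1%:R.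
  by have := truncn_itv (ltW u0); rewrite -/k => /andP[].
have kK0 : (K0 <= k)%N.
  by rewrite -ltnS -(ltr_nat R) (lt_trans _ uk2)// (lt_trans _ uK)// ltr_nat.
(* k + 1 > u, so mu_k <= k2 (k + 1)^(-2m) <= k2 u^(-2m) = k2 r. *)
have muk : mu k <= k2 / l1 * lam n.
  have [_ +] := HK0 k kK0; rewrite (ger0_norm (mu0 k)) (ger0_norm (powR_ge0 _ _)) => h1.
  apply: le_trans h1 _; rewrite -mulrA ler_wpM2l ?(ltW k20)//.
  rewrite ler_pdivlMl//; apply: le_trans lam1; rewrite ler_wpM2l ?(ltW l10)//.
  rewrite rE !powRN lef_pV2 ?posrE ?powR_gt0//.
  by rewrite ge0_ler_powR ?nnegrE ?(ltW uk2)// ?(ltW u0)//; lra.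
have trA w : \tr (smoother (kernel_mx K (fun i => x n i w)) (S n w) (lam n)) <= 2 * u * C3.
  have := mxtrace_smoother_le hH hK hM (S n w) n0 (fun i => hxX n i w) (hlam0 n) (hC k).
  move=> htr.
  have kmu0 : 0 <= k.+1%:R * mu k by rewrite mulr_ge0.
  have hCC : C * (k.+1%:R * mu k) <= `|C| * (k.+1%:R * (k2 / l1 * lam n)).
    apply: (@le_trans _ _ (`|C| * (k.+1%:R * mu k))).
      by rewrite ler_wpM2r// ler_norm.
    by rewrite ler_wpM2l// ler_wpM2l.
  have : lam n * \tr (smoother (kernel_mx K (fun i => x n i w)) (S n w) (lam n)) <=
     lam n * (k.+1%:R * C3).
    apply: le_trans htr _; rewrite /C3.
    have := ler_wpM2l (sqr_ge0 M) hCC; lra.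
  rewrite ler_pM2l// => htr'; apply: le_trans htr' _; rewrite ler_wpM2r//.
  rewrite -natr1; lra.
have sL : (L <= s_lam mu (lam n))%N.
  apply: s_lam_ge => //; last exact: (poly_decay_small mu0 m0 hmu).
  apply: le_lt_trans lam2 _; rewrite mulrC -ltr_pdivlMr//.
  rewrite /r; near: n; apply: powRN_small => //; exact: divr_gt0.
have hA2an : D * (s_lam mu (lam n))%:R <= (s n)%:R by near: n; exact: hA2a.
have sn : L%:R <= (s n)%:R :> R.
  apply: le_trans hA2an; apply: (@le_trans _ _ (s_lam mu (lam n))%:R).
    by rewrite ler_nat.
  by rewrite ler_peMl.
have hsat : ab_type (P n) (g_sigma_preimage (x n))
   [set w | satisfiable c (lam n) (kernel_mx K (fun i => x n i w)) (S n w)]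
   (c1 * (s n)%:R%:E)%E (c2 * (s_lam mu (lam n))%:R%:E)%E by near: n; exact: hA2b.
have PE : (P n (~` [set w | satisfiable c (lam n) (kernel_mx K (fun i => x n i w)) (S n w)])
    <= (e1 *+ 2)%:E)%E.
  apply: ab_type_prob hsat => //.
  - by apply: g_sigma_preimage_measurable => i; exact: measurable_funPT.
  - by apply: hB1; exact: le_trans hL.1 sn.
  - by apply: hB2; apply: le_trans hL.2 _; rewrite ler_nat.
have [_ _ mE _] := hsat.
have := @emp_error_tail _ _ _ X PX K H ip mu phi hH hHL2 hK _ _ (P n) n (s n)
  (x n) (eps n) (S n) (lam n) f0 n0 (hxX n) (heps n) (mS n) (hind n) (hlam0 n) hf0
  c (2 * u * C3) (Q * u) ((h * l2 * (3 + c ^+ 2 *+ 6) + Q) *+ 2 * r) (e1 *+ 2)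
  trA (mulr_gt0 Q0 u0) _ mE PE.
move=> tail; apply: le_trans (tail _) _.
  set G := 3 + c ^+ 2 *+ 6; have G0 : 0 <= G by have := sqr_ge0 c; rewrite /G; lra.
  have -> : n%:R^-1 * ((n%:R * h * lam n * G + Q * u) *+ 2) =
      (h * G * lam n + Q * r) *+ 2 by rewrite -nr; field; rewrite gt_eqF.
  by have := ler_wpM2l (mulr_ge0 h0 G0) lam2; lra.
rewrite lee_fin.
have : normal_m2 * (2 * u * C3) / (Q * u) <= e / 2.
  rewrite ler_pdivrMr ?mulr_gt0// /Q.
  have -> : e / 2 * ((4 * normal_m2 * C3 / e + 1) * u) =
    normal_m2 * (2 * u * C3) + e / 2 * u by field; rewrite gt_eqF.
  by rewrite lerDl mulr_ge0 ?(ltW u0)// divr_ge0 ?ltW.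
move: e14; lra.
Unshelve. all: by end_near. Qed.
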